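(* Let $S$ be a regular countably compact semitopological semigroup which is algebraically a primitive inverse semigroup, $S=\sum_{i\in\mathscr I}B_{\lambda_i}(G_i)$. Suppose that for every $i\in\mathscr I$ there is $\alpha_i\in\lambda_i$ such that at least one of the following holds: (1) the maximal subgroup $(G_i)_{\alpha_i,\alpha_i}$ (subspace topology) is left precompact; (2) $(G_i)_{\alpha_i,\alpha_i}$ is left $\omega$-precompact and pseudocompact; (3) the subsemigroup $(G_i)_{\alpha_i,\alpha_i}\cup\{0\}$ is a topological semigroup. Then $S$ is Tychonoff, and its Stone–Čech compactification $\beta S$ admits a structure of a primitive inverse semitopological semigroup with continuous inversion with respect to which the inclusion $S\hookrightarrow\beta S$ is a topological isomorphism onto its image. Moreover, $\beta S$ is topologically isomorphic to the orthogonal sum $\sum_{i\in\mathscr I}B_{\lambda_i}(\beta G_i)$, where each $\beta G_i$ (the Stone–Čech compactification of $G_i$, topologized as $(G_i)_{\alpha_i,\alpha_i}$) is a compact topological group and each $B_{\lambda_i}(\beta G_i)$ is a compact semitopological Brandt semigroup whose subspaces $(\beta G_i)_{\alpha,\alpha}$ are homeomorphic to $\beta G_i$ via $g\mapsto(\alpha,g,\alpha)$.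
   Context: All spaces are Hausdorff; a semitopological (topological) semigroup is a Hausdorff space with separately (jointly) continuous associative operation. For a group $G$ and cardinal $\lambda\ge1$, $B_\lambda(G)=(\lambda\times G\times\lambda)\cup\{0\}$ with $(\alpha,a,\beta)(\gamma,b,\delta)=(\alpha,ab,\delta)$ if $\beta=\gamma$ and $0$ otherwise. The orthogonal sum of semigroups $T_\iota$ with zeros is $\{0\}\cup\bigcup_\iota(T_\iota\setminus\{0_\iota\})$ with products computed in $T_\iota$ when both factors lie in the same $T_\iota$ and the product is non-zero, and $0$ otherwise. Primitive inverse semigroups are exactly orthogonal sums $\sum_{i\in\mathscr I}B_{\lambda_i}(G_i)$; we identify $B_{\lambda_i}(G_i)$ with a subsemigroup of $S$ and write $(G_i)_{\alpha,\beta}=\{(\alpha,g,\beta):g\in G_i\}$. A group with topology is left precompact (left $\omega$-precompact) if for every neighbourhood $U$ of the unit there is a finite (countable) $F$ with $FU=G$. Pseudocompact: every locally finite family of non-empty open sets is finite. *)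

(* Defs.v *)
From Stdlib Require Import Reals List.
Open Scope R_scope.

Definition is_topology {X : Type} (op : (X -> Prop) -> Prop) : Prop :=
  op (fun _ => True) /\
  (forall U V, op U -> op V -> op (fun x => U x /\ V x)) /\
  (forall F : (X -> Prop) -> Prop, (forall U, F U -> op U) ->
     op (fun x => exists U, F U /\ U x)).

Definition hausdorff {X : Type} (op : (X -> Prop) -> Prop) : Prop :=
  forall x y : X, x <> y -> exists U V, op U /\ op V /\ U x /\ V y /\
    (forall w, ~ (U w /\ V w)).

Definition closed {X : Type} (op : (X -> Prop) -> Prop) (C : X -> Prop) : Prop :=
  op (fun x => ~ C x).

(* regular (Hausdorff by the standing convention) *)
Definition regular {X : Type} (op : (X -> Prop) -> Prop) : Prop :=
  hausdorff op /\
  forall (C : X -> Prop) (x : X), closed op C -> ~ C x ->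
    exists U V, op U /\ op V /\ U x /\ (forall y, C y -> V y) /\
      (forall w, ~ (U w /\ V w)).

Definition continuous {X Y : Type} (opX : (X -> Prop) -> Prop)
  (opY : (Y -> Prop) -> Prop) (f : X -> Y) : Prop :=
  forall V, opY V -> opX (fun x => V (f x)).

Definition R_top : (R -> Prop) -> Prop :=
  fun U => forall x, U x -> exists eps, 0 < eps /\
    forall y, Rabs (y - x) < eps -> U y.

Definition tychonoff {X : Type} (op : (X -> Prop) -> Prop) : Prop :=
  hausdorff op /\
  forall (C : X -> Prop) (x : X), closed op C -> ~ C x ->
    exists f : X -> R, continuous op R_top f /\ f x = 0 /\
      (forall y, C y -> f y = 1) /\ (forall y, 0 <= f y <= 1).

Definition compact_on {X : Type} (op : (X -> Prop) -> Prop) (A : X -> Prop) : Prop :=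
  forall F : (X -> Prop) -> Prop, (forall U, F U -> op U) ->
    (forall x, A x -> exists U, F U /\ U x) ->
    exists l : list (X -> Prop), (forall U, In U l -> F U) /\
      (forall x, A x -> exists U, In U l /\ U x).

Definition compact_space {X : Type} (op : (X -> Prop) -> Prop) : Prop :=
  compact_on op (fun _ => True).

Definition countably_compact {X : Type} (op : (X -> Prop) -> Prop) : Prop :=
  forall U : nat -> X -> Prop, (forall n, op (U n)) -> (forall x, exists n, U n x) ->
    exists N, forall x, exists n, (n <= N)%nat /\ U n x.

Definition pseudocompact {X : Type} (op : (X -> Prop) -> Prop) : Prop :=
  forall F : (X -> Prop) -> Prop,
    (forall U, F U -> op U /\ exists x, U x) ->
    (forall x, exists W, op W /\ W x /\
        exists l : list (X -> Prop), forall U, F U -> (exists y, U y /\ W y) -> In U l) ->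
    exists l : list (X -> Prop), forall U, F U -> In U l.

Definition dense {X : Type} (op : (X -> Prop) -> Prop) (A : X -> Prop) : Prop :=
  forall U, op U -> (exists x, U x) -> exists x, U x /\ A x.

Definition embedding {Y X : Type} (opY : (Y -> Prop) -> Prop)
  (opX : (X -> Prop) -> Prop) (h : Y -> X) : Prop :=
  (forall y y', h y = h y' -> y = y') /\ continuous opY opX h /\
  (forall V, opY V -> exists U, opX U /\ forall y, V y <-> U (h y)).

(* the topology induced on Y by h : Y -> X (for injective h: the subspace topology
   of the image transported to Y) *)
Definition pullback {Y X : Type} (opX : (X -> Prop) -> Prop) (h : Y -> X) :
  (Y -> Prop) -> Prop :=
  fun V => exists U, opX U /\ forall y, V y <-> U (h y).

Definition stone_cech {X B : Type} (opX : (X -> Prop) -> Prop)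
  (opB : (B -> Prop) -> Prop) (j : X -> B) : Prop :=
  is_topology opB /\ compact_space opB /\ hausdorff opB /\ embedding opX opB j /\
  dense opB (fun b => exists x, b = j x) /\
  forall f : X -> R, continuous opX R_top f -> (exists M, forall x, Rabs (f x) <= M) ->
    exists g : B -> R, continuous opB R_top g /\ forall x, g (j x) = f x.

Definition prod_top {X Y : Type} (opX : (X -> Prop) -> Prop) (opY : (Y -> Prop) -> Prop) :
  (X * Y -> Prop) -> Prop :=
  fun W => forall p, W p -> exists U V, opX U /\ opY V /\ U (fst p) /\ V (snd p) /\
    forall x y, U x -> V y -> W (x, y).

Definition associative {S : Type} (m : S -> S -> S) : Prop :=
  forall x y z, m x (m y z) = m (m x y) z.

Definition is_group {G : Type} (m : G -> G -> G) (e : G) (inv : G -> G) : Prop :=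
  associative m /\
  forall x, m e x = x /\ m x e = x /\ m (inv x) x = e /\ m x (inv x) = e.

Definition semitopological_semigroup {S : Type} (op : (S -> Prop) -> Prop)
  (m : S -> S -> S) : Prop :=
  is_topology op /\ hausdorff op /\ associative m /\
  (forall a, continuous op op (fun x => m a x)) /\
  (forall a, continuous op op (fun x => m x a)).

Definition topological_group {G : Type} (op : (G -> Prop) -> Prop)
  (m : G -> G -> G) (e : G) (inv : G -> G) : Prop :=
  is_topology op /\ hausdorff op /\ is_group m e inv /\
  continuous (prod_top op op) op (fun p => m (fst p) (snd p)) /\
  continuous op op inv.

Definition jointly_continuous_on {S : Type} (op : (S -> Prop) -> Prop)
  (m : S -> S -> S) (P : S -> Prop) : Prop :=
  forall x y, P x -> P y -> forall W, op W -> W (m x y) ->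
    exists U V, op U /\ op V /\ U x /\ V y /\
      forall x' y', P x' -> P y' -> U x' -> V y' -> W (m x' y').

Definition inverse_semigroup {S : Type} (m : S -> S -> S) : Prop :=
  associative m /\
  forall x, exists! y, m (m x y) x = x /\ m (m y x) y = y.

Definition primitive_with_zero {S : Type} (m : S -> S -> S) (z : S) : Prop :=
  (forall x, m z x = z /\ m x z = z) /\
  forall e f, m e e = e -> m f f = f -> e <> z -> f <> z ->
    (m e f = e /\ m f e = e) -> e = f.

(* (S, m, z) is (algebraically) the orthogonal sum of the Brandt semigroups
   B_{Lam i}(G i), the element (a, g, b) of the i-th summand being E i a g b *)
Definition orth_sum_decomp {I S : Type} (Lam : I -> Type) (G : I -> Type)
  (gm : forall i, G i -> G i -> G i) (m : S -> S -> S) (z : S)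
  (E : forall i, Lam i -> G i -> Lam i -> S) : Prop :=
  (forall x, m z x = z /\ m x z = z) /\
  (forall i a g b, E i a g b <> z) /\
  (forall x, x = z \/ exists i a g b, x = E i a g b) /\
  (forall i a g b a' g' b', E i a g b = E i a' g' b' -> a = a' /\ g = g' /\ b = b') /\
  (forall i j a g b a' g' b', i <> j -> E i a g b <> E j a' g' b') /\
  (forall i a g b h d, m (E i a g b) (E i b h d) = E i a (gm i g h) d) /\
  (forall i a g b c h d, b <> c -> m (E i a g b) (E i c h d) = z) /\
  (forall i j a g b c h d, i <> j -> m (E i a g b) (E j c h d) = z).

Definition brandt_block {I S : Type} {Lam : I -> Type} {G : I -> Type}
  (E : forall i, Lam i -> G i -> Lam i -> S) (z : S) (i : I) : S -> Prop :=
  fun x => x = z \/ exists a g b, x = E i a g b.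

Definition left_precompact {G : Type} (op : (G -> Prop) -> Prop)
  (m : G -> G -> G) (e : G) : Prop :=
  forall U, op U -> U e ->
    exists F : list G, forall g, exists f u, In f F /\ U u /\ g = m f u.

Definition left_omega_precompact {G : Type} (op : (G -> Prop) -> Prop)
  (m : G -> G -> G) (e : G) : Prop :=
  forall U, op U -> U e ->
    exists F : nat -> G, forall g, exists n u, U u /\ g = m (F n) u.

(* Main.v *)
(* Every block of [S] is an open copy of [G i], and every neighbourhood of zero contains
   all but finitely many blocks.  A locally countably compact regular semitopological
   group is a topological group: if V were not contained in cl(U^-1) one could pick
   y(n+1) in y(n)V outside cl(y(n)U^-1) and contradict a cluster point, and joint
   continuity follows from a Grothendieck-style double limit built along such choices.
   Each of the three conditions forces zero to be isolated from each block, so every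
   [G i] is a countably compact topological group, hence precompact, and continuous
   real functions on it are uniformly continuous.  So the Stone-Cech compactification of
   [G i] is its group completion, and beta S is the orthogonal sum of the Brandt
   semigroups over these, glued at zero like a one-point compactification. *)
From mathcomp Require filter.
From Stdlib Require Import Reals List Lra Lia Classical ClassicalEpsilon
  FunctionalExtensionality PropExtensionality Eqdep.
Require Import Defs.

(** * Topological preliminaries *)

(** Countable compactness is always used through cluster points of sequences built by dependent
    choice; no convergent subsequence is ever available. Precompactness of [G i] has a second use
    besides compactness of the completion: it makes conjugation-invariant neighbourhoods a base at
    the unit, so the left and right uniformities coincide. This is why minimal Cauchy filters can be
    multiplied and inverted, and why the completion is a group. The gluing needs no further group
    theory. Open sets of [S] are described by their traces on the blocks and a cofiniteness
    condition at zero, and the same description defines the topology of the sum over the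
    completions. Only separate continuity can be expected at zero: for infinite [Lam i] the factors
    of [(a,e,b)(b,e,a)] tend to zero as [b] varies, while the product is the constant [(a,e,a)]. *)

Lemma dependent_choice {A : Type} (P : A -> Prop) (R : A -> A -> Prop) (a0 : A) :
  P a0 -> (forall a, P a -> exists b, P b /\ R a b) ->
  exists f : nat -> A, f 0%nat = a0 /\ forall n, P (f n) /\ R (f n) (f (S n)).
Proof.
  intros H0 HR.
  assert (step : forall a : {a | P a}, {b : {b | P b} | R (proj1_sig a) (proj1_sig b)}).
  { intros [a Ha]. apply constructive_indefinite_description.
    destruct (HR a Ha) as [b [Hb Hab]]. exists (exist _ b Hb). exact Hab. }
  pose (f := fix f (n : nat) : {a | P a} :=
    match n with O => exist _ a0 H0 | S k => proj1_sig (step (f k)) end).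
  exists (fun n => proj1_sig (f n)). split; [reflexivity|].
  intros n. split; [exact (proj2_sig (f n)) | exact (proj2_sig (step (f n)))].
Qed.

Definition cl {X : Type} (op : (X -> Prop) -> Prop) (A : X -> Prop) (x : X) : Prop :=
  forall W, op W -> W x -> exists w, W w /\ A w.

Definition cluster {X : Type} (op : (X -> Prop) -> Prop) (u : nat -> X) (x : X) : Prop :=
  forall W, op W -> W x -> forall N, exists n, (N <= n)%nat /\ W (u n).

(** The working form of regularity; it passes to subspaces by pulling back. *)
Definition shrinking {X : Type} (op : (X -> Prop) -> Prop) : Prop :=
  forall U x, op U -> U x -> exists V, op V /\ V x /\ forall y, cl op V y -> U y.

Section Topology.
Context {X : Type} (op : (X -> Prop) -> Prop) (HT : is_topology op).

Lemma op_ext (U V : X -> Prop) : (forall x, U x <-> V x) -> op U -> op V.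
Proof.
  intros H HU. replace V with U; [exact HU|].
  apply functional_extensionality; intros x. apply propositional_extensionality, H.
Qed.

Lemma op_true : op (fun _ => True).
Proof. apply HT. Qed.

Lemma op_and U V : op U -> op V -> op (fun x => U x /\ V x).
Proof. apply HT. Qed.

Lemma op_local (U : X -> Prop) :
  (forall x, U x -> exists V, op V /\ V x /\ forall y, V y -> U y) -> op U.
Proof.
  intros H. destruct HT as [_ [_ Hu]].
  eapply op_ext; [|apply (Hu (fun V => op V /\ forall y, V y -> U y)); tauto].
  intros x. cbv beta. split.
  - intros [V [[_ HV] Hx]]. auto.
  - intros Hx. destruct (H x Hx) as [V [H1 [H2 H3]]]. exists V. tauto.
Qed.

Lemma op_false : op (fun _ => False).
Proof. apply op_local. tauto. Qed.

Lemma op_const (P : Prop) : op (fun _ => P).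
Proof.
  destruct (classic P) as [H|H].
  - apply (op_ext (fun _ => True)); [tauto|exact op_true].
  - apply (op_ext (fun _ => False)); [tauto|exact op_false].
Qed.

Lemma op_ex {T : Type} (P : T -> X -> Prop) :
  (forall t, op (P t)) -> op (fun x => exists t, P t x).
Proof.
  intros H. apply op_local. intros x [t Ht]. exists (P t). eauto.
Qed.

Lemma op_list {T : Type} (P : T -> X -> Prop) (l : list T) :
  (forall t, In t l -> op (P t)) -> op (fun x => forall t, In t l -> P t x).
Proof.
  induction l as [|a l IH]; intros H.
  - eapply op_ext; [|exact op_true]. simpl. tauto.
  - eapply op_ext; [|apply op_and; [apply (H a); left; reflexivity|apply IH]].
    + intros x; simpl. split.
      * intros [H1 H2] t [<-|Ht]; auto.
      * auto.
    + intros t Ht. apply H. right; exact Ht.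
Qed.

Lemma op_not_cl A : op (fun x => ~ cl op A x).
Proof.
  apply op_local. intros x Hx.
  assert (H : exists W, op W /\ W x /\ forall w, W w -> ~ A w).
  { apply NNPP. intros H. apply Hx. intros W HW Wx. apply NNPP. intros H'.
    apply H. exists W. repeat split; auto. intros w Ww Aw. apply H'. eauto. }
  destruct H as [W [HW [Wx HA]]]. exists W. repeat split; auto.
  intros y Wy Hy. destruct (Hy W HW Wy) as [w [H1 H2]]. exact (HA w H1 H2).
Qed.

Lemma cl_incl A x : A x -> cl op A x.
Proof. intros H W _ Wx. eauto. Qed.

Lemma cluster_cl u x A N :
  cluster op u x -> (forall n, (N <= n)%nat -> A (u n)) -> cl op A x.
Proof.
  intros Hu HA W HW Wx. destruct (Hu W HW Wx N) as [n [Hn Wn]]. eauto.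
Qed.

(** Without a cluster point, the open sets of points having a neighbourhood free of all terms from
    [N] on cover the space. They increase with [N], and the [N]-th one misses [u N], so no finite
    number of them suffices. *)
Lemma countably_compact_cluster :
  countably_compact op -> forall u : nat -> X, exists x, cluster op u x.
Proof.
  intros Hcc u. apply NNPP. intros Hno.
  destruct (Hcc (fun N x => exists W, (op W /\ forall n, (N <= n)%nat -> ~ W (u n)) /\ W x))
    as [N HN].
  - intros n. destruct HT as [_ [_ Hu]].
    apply (Hu (fun W => op W /\ forall k, (n <= k)%nat -> ~ W (u k))). tauto.
  - intros x. apply NNPP. intros Hx. apply Hno. exists x. intros W HW Wx N.
    apply NNPP. intros HnN. apply Hx. exists N, W. repeat split; auto.
    intros n Hn Wn. apply HnN. eauto.
  - destruct (HN (u N)) as [n [Hn [W [[_ HW] Wu]]]]. exact (HW N Hn Wu).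
Qed.

Lemma regular_shrinking : regular op -> shrinking op.
Proof.
  intros [_ Hr] U x HU Ux.
  destruct (Hr (fun y => ~ U y) x) as [V [W [HV [HW [Vx [HC Hd]]]]]].
  - unfold closed. eapply op_ext; [|exact HU]. intros y. simpl. split; [tauto|apply NNPP].
  - tauto.
  - exists V. repeat split; auto. intros y Hy. apply NNPP. intros Uy.
    destruct (Hy W HW (HC y Uy)) as [w [H1 H2]]. exact (Hd w (conj H2 H1)).
Qed.

Lemma hausdorff_op_neq : hausdorff op -> forall z, op (fun x => x <> z).
Proof.
  intros Hh z. apply op_local. intros x Hx.
  destruct (Hh x z Hx) as [U [V [HU [HV [Ux [Vz Hd]]]]]].
  exists U. repeat split; auto. intros y Uy ->. exact (Hd z (conj Uy Vz)).
Qed.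

End Topology.

Lemma cluster_continuous {X Y : Type} opX opY (f : X -> Y) u x :
  continuous opX opY f -> cluster opX u x -> cluster opY (fun n => f (u n)) (f x).
Proof. intros Hf Hu W HW Wx. exact (Hu (fun x => W (f x)) (Hf W HW) Wx). Qed.

Lemma cl_continuous {X Y : Type} opX opY (f : X -> Y) (A : X -> Prop) (B : Y -> Prop) x :
  continuous opX opY f -> (forall a, A a -> B (f a)) -> cl opX A x -> cl opY B (f x).
Proof.
  intros Hf HAB HA W HW Wx. destruct (HA (fun x => W (f x)) (Hf W HW) Wx) as [w [H1 H2]].
  eauto.
Qed.

(** * Cancellation rules in an abstract group and a tactic normalising words *)

Section Groups.
Context {G : Type} {m : G -> G -> G} {e : G} {inv : G -> G} (Hg : is_group m e inv).

Lemma g_assoc x y z : m (m x y) z = m x (m y z).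
Proof. symmetry. apply Hg. Qed.
Lemma g_1l x : m e x = x. Proof. apply Hg. Qed.
Lemma g_1r x : m x e = x. Proof. apply Hg. Qed.
Lemma g_Vl x : m (inv x) x = e. Proof. apply Hg. Qed.
Lemma g_Vr x : m x (inv x) = e. Proof. apply Hg. Qed.
Lemma g_Kl x y : m (inv x) (m x y) = y.
Proof. rewrite <- g_assoc, g_Vl, g_1l. reflexivity. Qed.
Lemma g_Kr x y : m x (m (inv x) y) = y.
Proof. rewrite <- g_assoc, g_Vr, g_1l. reflexivity. Qed.
Lemma g_inv_unique x y : m x y = e -> y = inv x.
Proof. intros H. rewrite <- (g_Kl x y), H, g_1r. reflexivity. Qed.
Lemma g_VV x : inv (inv x) = x.
Proof. symmetry. apply g_inv_unique, g_Vl. Qed.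
Lemma g_V1 : inv e = e.
Proof. symmetry. apply g_inv_unique, g_1l. Qed.
Lemma g_VM x y : inv (m x y) = m (inv y) (inv x).
Proof. symmetry. apply g_inv_unique. rewrite g_assoc, g_Kr, g_Vr. reflexivity. Qed.
End Groups.

Tactic Notation "grp" constr(Hg) :=
  repeat first [ rewrite (g_assoc Hg) | rewrite (g_1l Hg) | rewrite (g_1r Hg)
    | rewrite (g_Vl Hg) | rewrite (g_Vr Hg) | rewrite (g_Kl Hg) | rewrite (g_Kr Hg)
    | rewrite (g_VV Hg) | rewrite (g_V1 Hg) | rewrite (g_VM Hg) ].
Tactic Notation "grp" constr(Hg) "in" hyp(H) :=
  repeat first [ rewrite (g_assoc Hg) in H | rewrite (g_1l Hg) in H | rewrite (g_1r Hg) in H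
    | rewrite (g_Vl Hg) in H | rewrite (g_Vr Hg) in H | rewrite (g_Kl Hg) in H
    | rewrite (g_Kr Hg) in H
    | rewrite (g_VV Hg) in H | rewrite (g_V1 Hg) in H | rewrite (g_VM Hg) in H ].

(** * Locally countably compact semitopological groups *)

Section LocallyCountablyCompact.
Context {G : Type} {op : (G -> Prop) -> Prop} {m : G -> G -> G} {e : G} {inv : G -> G}.
Hypotheses (HT : is_topology op) (Hg : is_group m e inv)
  (Hl : forall a, continuous op op (fun x => m a x))
  (Hr : forall a, continuous op op (fun x => m x a))
  (Hs : shrinking op).
Context {K : G -> Prop}.
Hypotheses (HK : op K) (Ke : K e)
  (HKc : forall u : nat -> G, (forall n, K (u n)) -> exists x, cluster op u x).

(** Along with the points [y n] open sets [O n] are chosen, the closure of each inside the previous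
    one. A cluster point [g] of the [y n] therefore lies in all of them, and membership in the next
    set is arranged to put [g^-1 y n] outside [U]. Yet [y n] enters the neighbourhood [g U] of
    [g]. *)
Lemma cl_inverse_nbhd (U : G -> Prop) : op U -> U e ->
  exists V, op V /\ V e /\ forall v, V v -> cl op (fun x => U (inv x)) v.
Proof.
  intros HU Ue. apply NNPP. intros Hno.
  destruct (dependent_choice
    (fun s : G * (G -> Prop) => op (snd s) /\ snd s (fst s) /\ forall x, snd s x -> K x)
    (fun s t => (forall x, cl op (snd t) x -> snd s x) /\
                forall w, snd t w -> ~ U (m (inv w) (fst s)))
    (e, K)) as [f [_ Hf]].
  - simpl. auto.
  - intros [y O] [HO [Oy OK]]. simpl in *.
    assert (Hv : exists v, O (m y v) /\ ~ cl op (fun x => U (inv x)) v).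
    { apply NNPP. intros Hv. apply Hno. exists (fun v => O (m y v)). split; [|split].
      - exact (Hl y O HO).
      - rewrite (g_1r Hg). exact Oy.
      - intros v Ov. apply NNPP. intros Hc. apply Hv. eauto. }
    destruct Hv as [v [Ov Hv]].
    destruct (Hs (fun w => O w /\ ~ cl op (fun x => U (inv x)) (m (inv y) w)) (m y v))
      as [O' [HO' [Oy' HO'']]].
    + apply (op_and op HT); [exact HO|].
      exact (Hl (inv y) _ (op_not_cl op HT _)).
    + grp Hg. auto.
    + exists (m y v, O'). simpl. repeat split; auto.
      * intros x Ox. apply OK, HO'', (cl_incl op), Ox.
      * intros x Hx. apply HO'', Hx.
      * intros w Ow Uw. destruct (HO'' w (cl_incl op _ _ Ow)) as [_ Hw].
        apply Hw, (cl_incl op). grp Hg. exact Uw.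
  - destruct (HKc (fun n => fst (f n))) as [g Hcl].
    { intros n. destruct (Hf n) as [[_ [H1 H2]] _]. auto. }
    assert (Hmono : forall n k x, snd (f (k + n)%nat) x -> snd (f n) x).
    { intros n k. induction k as [|k IH]; simpl; auto.
      intros x Hx. apply IH. apply (Hf (k + n)%nat), (cl_incl op). exact Hx. }
    assert (Hin : forall n, snd (f n) g).
    { intros n. apply (Hf n). apply (cluster_cl op _ _ _ (S n) Hcl).
      intros k Hk. apply (Hmono (S n) (k - S n)%nat).
      replace (k - S n + S n)%nat with k by lia. exact (proj1 (proj2 (proj1 (Hf k)))). }
    destruct (Hcl (fun w => U (m (inv g) w)) (Hl (inv g) U HU)) with (N := 0%nat) as [n [_ Hn]].
    { grp Hg. exact Ue. }
    exact (proj2 (proj2 (Hf n)) g (Hin (S n)) Hn).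
Qed.

(** If it fails, points are chosen with [a i * y k] in [W1] for [i <= k], and with [x * y n] outside
    [cl W3] for every [x] in [A n]. Let [g] and [q] be cluster points of the [a i] and the [y k].
    Passing to [q] first and to [g] next puts [g * q] in [W3]; but [g] lies in every [A n], so no
    [g * y n] is in [W3], although these cluster at [g * q]. *)
Lemma mul_jointly_continuous_at_unit (W : G -> Prop) : op W -> W e ->
  exists N V, op N /\ op V /\ N e /\ V e /\ forall n v, N n -> V v -> W (m n v).
Proof.
  intros HW We. apply NNPP. intros Hno.
  (* One shrinking per limit: [W1] to [W2] for the [y k], [W2] to [W3] for the [a i], and [W3] to
     [W] so that a product outside [W] avoids [cl W3]. Intersecting with [K] keeps the products
     [a 1 * y n] where sequences cluster. *)
  destruct (Hs W e HW We) as [W3 [HW3 [W3e HW3c]]].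
  destruct (Hs W3 e HW3 W3e) as [W2 [HW2 [W2e HW2c]]].
  destruct (Hs (fun x => W2 x /\ K x) e (op_and op HT _ _ HW2 HK) (conj W2e Ke))
    as [W1 [HW1 [W1e HW1c]]].
  (* A new [a] taken from [Ei l] satisfies [b a^-1] in [W1] for all earlier [b], so [y = a^-1 v]
     with [v] near the unit keeps every [b y] in [W1]. The invariant that [A] lies in [cl (Ei l)]
     makes the choice possible. *)
  pose (Ei := fun (l : list G) x => forall b, In b l -> W1 (m b (inv x))).
  destruct (dependent_choice
    (fun s : (G -> Prop) * list G * G * G => let '(A, l, a, y) := s in
       op A /\ (exists x, A x) /\ (forall x, A x -> K x /\ cl op (Ei l) x))
    (fun s t => let '(A, l, a, y) := s in let '(A', l', a', y') := t in
       l' = a' :: l /\ A a' /\ (forall x, cl op A' x -> A x) /\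
       (forall b, In b l' -> W1 (m b y')) /\
       (forall x, A' x -> ~ cl op W3 (m x y')))
    (* The two units are placeholders; the genuine terms start at index 1. *)
    (K, nil, e, e)) as [f [Hf0 Hf]].
  - split; [exact HK|split; [eauto|]]. intros x Kx. split; auto.
    apply (cl_incl op). intros b [].
  - intros [[[A l] a0] y0] [HA [[x0 Ax0] HAK]].
    destruct (proj2 (HAK x0 Ax0) A HA Ax0) as [a [Aa Ea]].
    pose (l' := a :: l).
    (* The next set [A'] surrounds [n a], and its points must again be limits of points of [Ei l'].
       Taking [n] in [V], hence in the closure of inverses of admissible [u], guarantees this:
       [u^-1 a] belongs to [Ei l']. *)
    destruct (cl_inverse_nbhd (fun u => forall b, In b l' -> W1 (m b (m (inv a) u))))
      as [V [HV [Ve HVc]]].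
    { apply (op_list op HT). intros b _. exact (Hl (inv a) _ (Hl b _ HW1)). }
    { intros b Hb. grp Hg. destruct Hb as [<-|Hb]; [grp Hg; exact W1e|exact (Ea b Hb)]. }
    assert (Hnv : exists n v, (A (m n a) /\ V n) /\
      (forall b, In b l' -> W1 (m b (m (inv a) v))) /\ ~ W (m n v)).
    { apply NNPP. intros Hnv. apply Hno.
      exists (fun n => A (m n a) /\ V n),
        (fun v => forall b, In b l' -> W1 (m b (m (inv a) v))).
      split; [apply (op_and op HT); [exact (Hr a A HA)|exact HV]|].
      split; [apply (op_list op HT); intros b _; exact (Hl (inv a) _ (Hl b _ HW1))|].
      split; [rewrite (g_1l Hg); auto|].
      split.
      - intros b Hb. grp Hg. destruct Hb as [<-|Hb]; [grp Hg; exact W1e|exact (Ea b Hb)].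
      - intros n v H1 H2. apply NNPP. intros H3. apply Hnv. exists n, v. auto. }
    destruct Hnv as [n [v [[An Vn] [Hv Hnv]]]].
    destruct (Hs (fun x => (A x /\ V (m x (inv a))) /\ ~ cl op W3 (m x (m (inv a) v)))
      (m n a)) as [A' [HA' [A'x HA'c]]].
    { apply (op_and op HT); [apply (op_and op HT); [exact HA|exact (Hr (inv a) V HV)]|].
      exact (Hr (m (inv a) v) _ (op_not_cl op HT _)). }
    { grp Hg. auto. }
    exists (A', l', a, m (inv a) v). repeat split; auto.
    + eauto.
    + apply HAK, HA'c, (cl_incl op). assumption.
    + destruct (HA'c x (cl_incl op _ _ H)) as [[_ Vx] _].
      replace x with (m (m x (inv a)) a) by (grp Hg; reflexivity).
      apply (cl_continuous op op (fun t => m t a)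
        (fun t => forall b, In b l' -> W1 (m b (m (inv a) (inv t))))).
      * apply Hr.
      * intros t Ht b Hb. grp Hg. exact (Ht b Hb).
      * exact (HVc _ Vx).
    + intros x Hx. apply HA'c, Hx.
    + intros x Hx. apply HA'c, (cl_incl op), Hx.
  - pose (A := fun n => fst (fst (fst (f n)))). pose (l := fun n => snd (fst (fst (f n)))).
    pose (a := fun n => snd (fst (f n))). pose (y := fun n => snd (f n)).
    assert (HAK : forall n x, A n x -> K x).
    { intros n x. unfold A. specialize (Hf n). destruct (f n) as [[[A0 l0] a0] y0].
      intros Hx. apply Hf, Hx. }
    assert (HR : forall n, l (S n) = a (S n) :: l n /\ A n (a (S n)) /\
       (forall x, cl op (A (S n)) x -> A n x) /\
       (forall b, In b (l (S n)) -> W1 (m b (y (S n)))) /\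
       (forall x, A (S n) x -> ~ cl op W3 (m x (y (S n))))).
    { intros n. unfold A, l, a, y. specialize (Hf n).
      destruct (f n) as [[[A0 l0] a0] y0]. destruct (f (S n)) as [[[A1 l1] a1] y1].
      apply Hf. }
    clearbody A l a y. clear f Hf0 Hf.
    assert (Hmono : forall n k x, A (k + n)%nat x -> A n x).
    { intros n k. induction k as [|k IH]; simpl; auto.
      intros x Hx. apply IH. apply (HR (k + n)%nat), (cl_incl op). exact Hx. }
    assert (Hal : forall i k, In (a (S i)) (l (k + S i)%nat)).
    { intros i k. induction k as [|k IH]; simpl; destruct (HR i) as [-> _]; simpl; auto.
      destruct (HR (k + S i)%nat) as [-> _]. right; exact IH. }
    assert (Hay : forall i k, (i <= k)%nat -> W1 (m (a (S i)) (y (S k)))).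
    { intros i k Hik. apply (HR k). replace (S k) with (k - i + S i)%nat by lia. apply Hal. }
    destruct (HKc (fun n => a (S n))) as [g Hcg].
    { intros n. exact (HAK n _ (proj1 (proj2 (HR n)))). }
    assert (Hgin : forall n, A n g).
    { intros n. apply (HR n). apply (cluster_cl op _ _ _ (S n) Hcg).
      intros k Hk. apply (Hmono (S n) (k - S n)%nat).
      replace (k - S n + S n)%nat with k by lia. exact (proj1 (proj2 (HR k))). }
    (* The [y n] need not lie in [K], but their translates by [a 1] do; a cluster point of these is
       translated back. *)
    destruct (HKc (fun n => m (a 1%nat) (y (S n)))) as [t Hct].
    { intros n. apply HW1c, (cl_incl op), Hay. lia. }
    assert (Hcy : cluster op (fun n => y (S n)) (m (inv (a 1%nat)) t)).
    { pose proof (cluster_continuous op op _ _ _ (Hl (inv (a 1%nat))) Hct) as H.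
      intros P HP Pt N. destruct (H P HP Pt N) as [n [Hn Pn]]. exists n. split; auto.
      grp Hg in Pn. exact Pn. }
    set (q := m (inv (a 1%nat)) t) in *.
    assert (Haq : forall i, W2 (m (a (S i)) q)).
    { intros i. apply HW1c.
      apply (cluster_cl op _ _ _ i (cluster_continuous op op _ _ _ (Hl (a (S i))) Hcy)).
      intros n Hn. apply Hay, Hn. }
    assert (Hgq : W3 (m g q)).
    { apply HW2c.
      apply (cluster_cl op _ _ _ 0%nat (cluster_continuous op op _ _ _ (Hr q) Hcg)).
      intros n _. apply Haq. }
    destruct (cluster_continuous op op _ _ _ (Hl g) Hcy W3 HW3 Hgq 0%nat) as [n [_ Hn]].
    exact (proj2 (proj2 (proj2 (proj2 (HR n)))) g (Hgin (S n)) (cl_incl op _ _ Hn)).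
Qed.

(** Write [v^-1 = (v^-1 w) w^-1], where [w] is so close to [v] that the first factor is in [O], and
    is taken from [U^-1] so that the second is in [U]. Such a [w] exists because [v] is in the
    closure of [U^-1]. *)
Lemma inverse_continuous_at_unit (W : G -> Prop) : op W -> W e ->
  exists V, op V /\ V e /\ forall v, V v -> W (inv v).
Proof.
  intros HW We.
  destruct (mul_jointly_continuous_at_unit W HW We) as [O [U [HO [HU [Oe [Ue HOU]]]]]].
  destruct (cl_inverse_nbhd U HU Ue) as [V [HV [Ve HVc]]].
  exists V. repeat split; auto. intros v Vv.
  destruct (HVc v Vv (fun w => O (m (inv v) w)) (Hl (inv v) O HO)) as [w [Ow Uw]].
  { grp Hg. exact Oe. }
  replace (inv v) with (m (m (inv v) w) (inv w)) by (grp Hg; reflexivity). auto.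
Qed.

Theorem locally_countably_compact_topological_group :
  hausdorff op -> topological_group op m e inv.
Proof.
  intros Hh. split; [exact HT|split; [exact Hh|split; [exact Hg|split]]].
  - intros W HW [x y] Wxy. simpl in Wxy.
    destruct (mul_jointly_continuous_at_unit (fun t => W (m x (m t y))))
      as [N [V [HN [HV [Ne [Ve HNV]]]]]].
    { exact (Hr y _ (Hl x W HW)). }
    { grp Hg. exact Wxy. }
    exists (fun a => N (m (inv x) a)), (fun b => V (m b (inv y))). simpl.
    split; [exact (Hl _ _ HN)|split; [exact (Hr _ _ HV)|]].
    split; [grp Hg; exact Ne|split; [grp Hg; exact Ve|]].
    intros a b Na Vb. specialize (HNV _ _ Na Vb). grp Hg in HNV. exact HNV.
  - intros W HW. apply (op_local op HT). intros x Wx.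
    destruct (inverse_continuous_at_unit (fun t => W (m t (inv x)))) as [V [HV [Ve HVc]]].
    { exact (Hr _ _ HW). }
    { grp Hg. exact Wx. }
    exists (fun t => V (m (inv x) t)). split; [exact (Hl _ _ HV)|split; [grp Hg; exact Ve|]].
    intros t Vt. specialize (HVc _ Vt). grp Hg in HVc. exact HVc.
Qed.

End LocallyCountablyCompact.

(** * Countably compact topological groups *)

(** The history is carried in the state, so each term can be chosen against all earlier ones. The
    initial entry [x0] is a placeholder, which is why the sequence is read from index 1. *)
Lemma sequence_of_lists {X : Type} (P : list X -> X -> Prop) :
  (forall l, exists x, P l x) ->
  exists u : nat -> X, forall n, exists l, P l (u n) /\ forall i, (i < n)%nat -> In (u i) l.
Proof.
  intros H.
  destruct (H nil) as [x0 _].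
  destruct (dependent_choice (fun _ : list X * X => True)
    (fun s t => P (fst s) (snd t) /\ fst t = snd t :: fst s) (nil, x0)) as [f [_ Hf]].
  - exact I.
  - intros [l x] _. destruct (H l) as [y Hy]. exists (y :: l, y). simpl. auto.
  - exists (fun n => snd (f (S n))). intros n. exists (fst (f n)). split; [apply Hf|].
    intros i Hi. replace n with ((n - S i) + S i)%nat by lia.
    induction (n - S i)%nat as [|k IH]; simpl.
    + rewrite (proj2 (proj2 (Hf i))). left; reflexivity.
    + rewrite (proj2 (proj2 (Hf (k + S i)%nat))). right; exact IH.
Qed.

Lemma ball_R_top (c d : R) : R_top (fun r => Rabs (r - c) < d).
Proof.
  intros x Hx. exists (d - Rabs (x - c)). split; [lra|]. intros y Hy.
  replace (y - c) with ((y - x) + (x - c)) by ring.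
  pose proof (Rabs_triang (y - x) (x - c)). lra.
Qed.

Section TopologicalGroup.
Context {G : Type} {op : (G -> Prop) -> Prop} {m : G -> G -> G} {e : G} {inv : G -> G}.
Hypothesis HTG : topological_group op m e inv.

Lemma tg_topology : is_topology op.
Proof. exact (proj1 HTG). Qed.
Lemma tg_group : is_group m e inv.
Proof. exact (proj1 (proj2 (proj2 HTG))). Qed.

Lemma tg_mul (W : G -> Prop) x y : op W -> W (m x y) ->
  exists U V, op U /\ op V /\ U x /\ V y /\ forall a b, U a -> V b -> W (m a b).
Proof.
  intros HW Wxy. destruct HTG as [_ [_ [_ [Hm _]]]].
  exact (Hm W HW (x, y) Wxy).
Qed.

Lemma tg_inv : continuous op op inv.
Proof. apply HTG. Qed.

Lemma tg_l a : continuous op op (fun x => m a x).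
Proof.
  intros W HW. apply (op_local op tg_topology). intros x Wx.
  destruct (tg_mul W a x HW Wx) as [U [V [_ [HV [Ua [Vx H]]]]]].
  exists V. auto.
Qed.

Lemma tg_r a : continuous op op (fun x => m x a).
Proof.
  intros W HW. apply (op_local op tg_topology). intros x Wx.
  destruct (tg_mul W x a HW Wx) as [U [V [HU [_ [Ux [Va H]]]]]].
  exists U. auto.
Qed.

Lemma tg_half (W : G -> Prop) : op W -> W e ->
  exists V, op V /\ V e /\ (forall x, V x -> V (inv x)) /\
    forall a b, V a -> V b -> W (m a b).
Proof.
  intros HW We. destruct (tg_mul W e e HW) as [U [V [HU [HV [Ue [Ve H]]]]]].
  { rewrite (g_1l tg_group). exact We. }
  exists (fun x => (U x /\ V x) /\ U (inv x) /\ V (inv x)).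
  assert (HUV := op_and op tg_topology _ _ HU HV).
  split; [|split; [|split]].
  - apply (op_and op tg_topology); [exact HUV|exact (tg_inv _ HUV)].
  - rewrite (g_V1 tg_group). auto.
  - intros x Hx. rewrite (g_VV tg_group). tauto.
  - intros a b [[Ua _] _] [[_ Vb] _]. auto.
Qed.

(** Two terms in the same translate [x V] differ by an element of [V^-1 V], which lies in [U]. *)
Lemma separated_no_cluster (U : G -> Prop) (u : nat -> G) : op U -> U e ->
  (forall i j, (i < j)%nat -> ~ U (m (inv (u i)) (u j))) ->
  forall x, ~ cluster op u x.
Proof.
  intros HU Ue Hsep x Hx.
  destruct (tg_half U HU Ue) as [V [HV [Ve [HVs HVV]]]].
  assert (HxV : op (fun y => V (m (inv x) y))) by exact (tg_l _ _ HV).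
  assert (Vxx : V (m (inv x) x)) by (grp tg_group; exact Ve).
  destruct (Hx _ HxV Vxx 0%nat) as [i [_ Vi]].
  destruct (Hx _ HxV Vxx (S i)) as [j [Hj Vj]].
  apply (Hsep i j Hj).
  specialize (HVV _ _ (HVs _ Vi) Vj). grp tg_group in HVV. exact HVV.
Qed.

Lemma precompact_or_separated (U : G -> Prop) :
  (exists F : list G, forall g, exists f, In f F /\ U (m (inv f) g)) \/
  (exists u : nat -> G, forall i j, (i < j)%nat -> ~ U (m (inv (u i)) (u j))).
Proof.
  destruct (classic (exists F : list G, forall g, exists f, In f F /\ U (m (inv f) g)))
    as [H|H]; [left; exact H|right].
  destruct (sequence_of_lists (fun l g => forall f, In f l -> ~ U (m (inv f) g)))
    as [u Hu].
  - intros l. apply NNPP. intros Hl. apply H. exists l. intros g.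
    apply NNPP. intros Hn. apply Hl. exists g. intros f Hf HU. apply Hn. eauto.
  - exists u. intros i j Hij. destruct (Hu j) as [l [H1 H2]]. auto.
Qed.

(** Conjugation invariance makes [x^-1 y] and [y x^-1] lie in [N] simultaneously, so a single
    uniformity serves both sides. *)
Definition inv_nbhd (N : G -> Prop) : Prop :=
  op N /\ N e /\ (forall x, N x -> N (inv x)) /\
  (forall g x, N x -> N (m g (m x (inv g)))).

Lemma inv_nbhd_and N N' : inv_nbhd N -> inv_nbhd N' -> inv_nbhd (fun x => N x /\ N' x).
Proof.
  intros [H1 [H2 [H3 H4]]] [H1' [H2' [H3' H4']]].
  split; [apply (op_and op tg_topology); assumption|].
  split; [auto|split]; intros; split; firstorder.
Qed.

Lemma inv_nbhd_comm N x y : inv_nbhd N -> N (m x y) -> N (m y x).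
Proof.
  intros [_ [_ [_ H]]] Hxy. specialize (H y _ Hxy). grp tg_group in H. exact H.
Qed.

Lemma inv_nbhd_translate N x : inv_nbhd N -> op (fun y => N (m (inv x) y)).
Proof. intros [H _]. exact (tg_l (inv x) N H). Qed.

Hypothesis HC : forall u : nat -> G, exists x, cluster op u x.

Lemma countably_compact_precompact (U : G -> Prop) : op U -> U e ->
  exists F : list G, forall g, exists f, In f F /\ U (m (inv f) g).
Proof.
  intros HU Ue. destruct (precompact_or_separated U) as [H|[u Hu]]; [exact H|].
  destruct (HC u) as [x Hx]. destruct (separated_no_cluster U u HU Ue Hu x Hx).
Qed.

(** Precompactness reduces conjugation by all of [G] to conjugation by a finite [F] with [G = F W]:
    if [g^-1 = f w], then [g v g^-1 = w^-1 (f^-1 v f) w], a product of three elements of [W]. The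
    union of all conjugates of [V] is therefore still small, and it is invariant. *)
Lemma inv_nbhd_base (U : G -> Prop) : op U -> U e ->
  exists N, inv_nbhd N /\ forall a b, N a -> N b -> U (m a b).
Proof.
  intros HU Ue.
  destruct (tg_half U HU Ue) as [U1 [HU1 [U1e [_ HU1m]]]].
  destruct (tg_half U1 HU1 U1e) as [U2 [HU2 [U2e [HU2s HU2m]]]].
  destruct (tg_half U2 HU2 U2e) as [W [HW [We [HWs HWm]]]].
  destruct (countably_compact_precompact W HW We) as [F HF].
  pose (V := fun v => forall f, In f F -> W (m (inv f) (m v f)) /\ W (m (inv f) (m (inv v) f))).
  assert (HV : op V).
  { apply (op_list op tg_topology (fun f v => W (m (inv f) (m v f)) /\ W (m (inv f) (m (inv v) f)))).
    intros f _. apply (op_and op tg_topology).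
    - exact (tg_r f _ (tg_l (inv f) _ HW)).
    - exact (tg_inv _ (tg_r f _ (tg_l (inv f) _ HW))). }
  assert (Ve : V e) by (intros f _; grp tg_group; auto).
  assert (HVU : forall g v, V v -> U1 (m g (m v (inv g)))).
  { intros g v Hv. destruct (HF (inv g)) as [f [Hf Wf]].
    destruct (Hv f Hf) as [Wv _].
    pose proof (HU2m _ _ (HWm _ _ (HWs _ Wf) Wv)
       (HWm _ _ Wf We)) as H.
    grp tg_group in H. exact H. }
  exists (fun x => exists g, V (m (inv g) (m x g))). split.
  - split; [|split; [|split]].
    + apply (op_ex op tg_topology (fun g x => V (m (inv g) (m x g)))). intros g.
      exact (tg_r g _ (tg_l (inv g) _ HV)).
    + exists e. grp tg_group. exact Ve.
    + intros x [g Hx]. exists g. intros f Hf. destruct (Hx f Hf) as [H1 H2].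
      grp tg_group. grp tg_group in H1. grp tg_group in H2. auto.
    + intros h x [g Hx]. exists (m h g). grp tg_group. exact Hx.
  - assert (HU1x : forall x, (exists g, V (m (inv g) (m x g))) -> U1 x).
    { intros x [g Hx]. specialize (HVU g _ Hx). grp tg_group in HVU. exact HVU. }
    intros a b Ha Hb. apply HU1m; auto.
Qed.

Lemma inv_nbhd_half (N : G -> Prop) : inv_nbhd N ->
  exists N', inv_nbhd N' /\ (forall a, N' a -> N a) /\ forall a b, N' a -> N' b -> N (m a b).
Proof.
  intros HN. destruct (inv_nbhd_base N (proj1 HN) (proj1 (proj2 HN))) as [N' [HN' H]].
  exists N'. repeat split; try apply HN'; auto. intros a Ha.
  rewrite <- (g_1r tg_group a). apply H; auto. apply HN'.
Qed.

Lemma inv_nbhd_exists : exists N, inv_nbhd N.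
Proof.
  destruct (inv_nbhd_base _ (op_true op tg_topology) I) as [N [HN _]]. eauto.
Qed.

Lemma inv_nbhd_inside (U : G -> Prop) x : op U -> U x ->
  exists N, inv_nbhd N /\ forall y, N (m (inv x) y) -> U y.
Proof.
  intros HU Ux. destruct (inv_nbhd_base (fun t => U (m x t))) as [N [HN H]].
  - exact (tg_l x U HU).
  - grp tg_group. exact Ux.
  - exists N. split; auto. intros y Hy. specialize (H _ e Hy (proj1 (proj2 HN))).
    grp tg_group in H. exact H.
Qed.

Lemma cl_inv_nbhd (N N' : G -> Prop) : inv_nbhd N' -> (forall a b, N' a -> N' b -> N (m a b)) ->
  forall x, cl op N' x -> N x.
Proof.
  intros HN' H x Hx.
  destruct (Hx _ (inv_nbhd_translate N' x HN')) as [w [H1 H2]].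
  { grp tg_group. apply HN'. }
  destruct HN' as [_ [_ [Hs _]]].
  specialize (H _ _ H2 (Hs _ H1)). grp tg_group in H. exact H.
Qed.

(* A failure of uniform continuity at scale [eps] yields pairs [x n], [y n] that agree
   modulo the closed subgroup [H], the intersection of the [N n]; since [f] is nearly
   constant on each coset [x n * H], it is nearly constant on the limit coset, which
   contains cluster points of both sequences. *)
Lemma countably_compact_uniformly_continuous (f : G -> R) (eps : R) :
  continuous op R_top f -> 0 < eps ->
  exists N, inv_nbhd N /\ forall x y, N (m (inv x) y) -> Rabs (f x - f y) < eps.
Proof.
  intros Hf Heps. apply NNPP. intros Hno.
  assert (Hfb : forall c d, op (fun x => Rabs (f x - c) < d))
    by (intros c d; exact (Hf _ (ball_R_top c d))).
  destruct inv_nbhd_exists as [N0 HN0].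
  destruct (dependent_choice
    (fun s : (G -> Prop) * G * G => inv_nbhd (fst (fst s)))
    (fun s t => let '(N, _, _) := s in let '(N', x, y) := t in
       N (m (inv x) y) /\ eps <= Rabs (f x - f y) /\
       (forall a b, N' a -> N' b -> N (m a b)) /\
       (forall a, N' a -> Rabs (f (m x a) - f x) < eps / 4))
    (N0, e, e)) as [s [_ Hs]].
  - exact HN0.
  - intros [[N x0] y0] HN. simpl in HN.
    assert (Hxy : exists x y, N (m (inv x) y) /\ eps <= Rabs (f x - f y)).
    { apply NNPP. intros H. apply Hno. exists N. split; auto. intros x y Hxy.
      apply Rnot_le_lt. intros Hle. apply H. eauto. }
    destruct Hxy as [x [y [HNxy Hxy]]].
    destruct (inv_nbhd_base (fun t => N t /\ Rabs (f (m x t) - f x) < eps / 4))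
      as [N' [HN' H]].
    + apply (op_and op tg_topology); [apply HN|exact (tg_l x _ (Hfb (f x) (eps / 4)))].
    + split; [apply HN|]. grp tg_group. rewrite Rminus_diag, Rabs_R0. lra.
    + exists (N', x, y). simpl. repeat split; auto.
      * apply HN'.
      * apply HN'.
      * apply HN'.
      * apply HN'.
      * intros a b Ha Hb. apply H; auto.
      * intros a Ha. rewrite <- (g_1r tg_group a). apply H; auto. apply HN'.
  - pose (N := fun n => fst (fst (s n))). pose (x := fun n => snd (fst (s (S n)))).
    pose (y := fun n => snd (s (S n))).
    assert (HN : forall n, inv_nbhd (N n)) by (intros n; apply (Hs n)).
    assert (HR : forall n, N n (m (inv (x n)) (y n)) /\ eps <= Rabs (f (x n) - f (y n)) /\
       (forall a b, N (S n) a -> N (S n) b -> N n (m a b)) /\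
       (forall a, N (S n) a -> Rabs (f (m (x n) a) - f (x n)) < eps / 4)).
    { intros n. unfold N, x, y. destruct (Hs n) as [_ H].
      destruct (s n) as [[? ?] ?]. destruct (s (S n)) as [[? ?] ?]. exact H. }
    clearbody N x y. clear s Hs.
    assert (Hsub : forall n k a, N (k + n)%nat a -> N n a).
    { intros n k. induction k as [|k IH]; simpl; auto. intros a Ha. apply IH.
      rewrite <- (g_1r tg_group a). apply (HR (k + n)%nat); auto. apply HN. }
    destruct (HC x) as [p Hp].
    (* The limits of [x] and [y] have to be taken along common indices: [nk k] picks a term of [x]
       close to [p] modulo [N k], and [q] is a cluster point of [y] along these indices. *)
    assert (Hk : forall k, exists n, (k <= n)%nat /\ N k (m (inv p) (x n)) /\
       Rabs (f (x n) - f p) < eps / 8).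
    { intros k. destruct (Hp (fun t => N k (m (inv p) t) /\ Rabs (f t - f p) < eps / 8))
        with (N := k) as [n [Hn H]].
      - apply (op_and op tg_topology); [apply inv_nbhd_translate, HN|apply Hfb].
      - grp tg_group. split; [apply HN|]. rewrite Rminus_diag, Rabs_R0. lra.
      - eauto. }
    destruct (choice _ Hk) as [nk Hnk].
    destruct (HC (fun k => y (nk k))) as [q Hq].
    assert (Ho : forall k, N k (m (inv p) q)).
    { intros k. apply (cl_inv_nbhd (N k) (N (S k)) (HN (S k)) (proj1 (proj2 (proj2 (HR k))))).
      apply (cluster_cl op (fun j => m (inv p) (y (nk j))) _ _ (S (S k))).
      - exact (cluster_continuous op op _ _ _ (tg_l (inv p)) Hq).
      - intros j Hj. destruct (Hnk j) as [Hj1 [Hj2 _]].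
        replace (m (inv p) (y (nk j)))
          with (m (m (inv p) (x (nk j))) (m (inv (x (nk j))) (y (nk j))))
          by (grp tg_group; reflexivity).
        apply (HR (S k)).
        + apply (Hsub (S (S k)) (j - S (S k))%nat).
          replace (j - S (S k) + S (S k))%nat with j by lia. exact Hj2.
        + apply (Hsub (S (S k)) (nk j - S (S k))%nat).
          replace (nk j - S (S k) + S (S k))%nat with (nk j) by lia. exact (proj1 (HR (nk j))). }
    set (o := m (inv p) q) in *.
    assert (Hpo : m p o = q) by (unfold o; grp tg_group; reflexivity).
    destruct (Hp (fun t => Rabs (f t - f p) < eps / 8 /\ Rabs (f (m t o) - f q) < eps / 8))
      with (N := 0%nat) as [n [_ [Hn1 Hn2]]].
    { apply (op_and op tg_topology); [apply Hfb|exact (tg_r o _ (Hfb (f q) (eps / 8)))]. }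
    { rewrite Hpo, !Rminus_diag, Rabs_R0. lra. }
    pose proof (proj2 (proj2 (proj2 (HR n))) o (Ho (S n))) as Hn3.
    destruct (Hq (fun t => Rabs (f t - f q) < eps / 8) (Hfb _ _)) with (N := 0%nat)
      as [k [_ Hk1]].
    { rewrite Rminus_diag, Rabs_R0. lra. }
    destruct (Hnk k) as [_ [_ Hk2]].
    pose proof (proj1 (proj2 (HR (nk k)))) as Hk3.
    (* Through [x n] and [x n * o], the values [f p] and [f q] differ by less than
       [eps/8 + eps/4 + eps/8]. The terms with index [nk k] add two more errors [eps/8], so [f]
       differs there by less than [3/4 eps], against the choice of the pairs. *)
    revert Hn1 Hn2 Hn3 Hk1 Hk2 Hk3. unfold Rabs.
    repeat destruct Rcase_abs; lra.
Qed.

End TopologicalGroup.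

(** * A Urysohn lemma for an abstract interpolating relation *)

Section Urysohn.
Context {X : Type} (op : (X -> Prop) -> Prop) (HT : is_topology op).
Context (ll : (X -> Prop) -> (X -> Prop) -> Prop).
Hypothesis ll_interpolate : forall A B, ll A B -> exists C, ll A C /\ ll C B.
Hypothesis ll_interior : forall A B, ll A B -> forall x, cl op A x ->
  exists O, op O /\ O x /\ forall y, O y -> B y.

Local Definition ury_mid (A B : X -> Prop) : X -> Prop :=
  epsilon (inhabits A) (fun C => ll A C /\ ll C B).

Local Lemma ury_mid_spec A B : ll A B -> ll A (ury_mid A B) /\ ll (ury_mid A B) B.
Proof.
  intros H. exact (epsilon_spec (inhabits A) (fun C => ll A C /\ ll C B) (ll_interpolate A B H)).
Qed.

(* Binary digits of the Urysohn function: bisect the gap between [A] and [B] and record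
   on which side of the intermediate set [x] lies. *)
Fixpoint urysohn_approx (n : nat) (A B : X -> Prop) (x : X) : R :=
  match n with
  | O => 0
  | S n => if excluded_middle_informative (ury_mid A B x)
           then urysohn_approx n A (ury_mid A B) x / 2
           else 1 / 2 + urysohn_approx n (ury_mid A B) B x / 2
  end.

Local Lemma ury_approx_bounds n : forall A B x, 0 <= urysohn_approx n A B x <= 1.
Proof.
  induction n as [|n IH]; intros A B x; simpl; [lra|].
  destruct excluded_middle_informative.
  - specialize (IH A (ury_mid A B) x). lra.
  - specialize (IH (ury_mid A B) B x). lra.
Qed.

Local Lemma ury_approx_growing n : forall A B x,
  urysohn_approx n A B x <= urysohn_approx (S n) A B x.
Proof.
  induction n as [|n IH]; intros A B x.
  - apply (ury_approx_bounds 1).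
  - simpl in *. destruct excluded_middle_informative.
    + specialize (IH A (ury_mid A B) x). simpl in IH. lra.
    + specialize (IH (ury_mid A B) B x). simpl in IH. lra.
Qed.

Local Lemma ury_approx_cv A B x : {l | Un_cv (fun n => urysohn_approx n A B x) l}.
Proof.
  apply growing_cv.
  - intros n. apply ury_approx_growing.
  - exists 1. intros r [n ->]. apply ury_approx_bounds.
Qed.

Local Definition ury_fun A B x : R := proj1_sig (ury_approx_cv A B x).

Local Lemma ury_fun_cv A B x : Un_cv (fun n => urysohn_approx n A B x) (ury_fun A B x).
Proof. exact (proj2_sig (ury_approx_cv A B x)). Qed.

Local Lemma ury_fun_bounds A B x : 0 <= ury_fun A B x <= 1.
Proof.
  pose proof (ury_fun_cv A B x) as H. split.
  - apply Rnot_lt_le. intros Hlt. destruct (H (- ury_fun A B x)) as [N HN]; [lra|].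
    specialize (HN N (Nat.le_refl N)). pose proof (ury_approx_bounds N A B x).
    unfold Rdist in HN. rewrite Rabs_pos_eq in HN; lra.
  - apply Rnot_lt_le. intros Hlt. destruct (H (ury_fun A B x - 1)) as [N HN]; [lra|].
    specialize (HN N (Nat.le_refl N)). pose proof (ury_approx_bounds N A B x).
    unfold Rdist in HN. rewrite Rabs_left in HN; lra.
Qed.

Local Lemma cv_affine (u v : nat -> R) (c l : R) :
  (forall n, v (S n) = c + u n / 2) -> Un_cv u l -> Un_cv v (c + l / 2).
Proof.
  intros Huv Hu eps Heps. destruct (Hu eps Heps) as [N HN]. exists (S N).
  intros [|n] Hn; [lia|]. rewrite Huv. specialize (HN n ltac:(lia)).
  unfold Rdist in *. replace (c + u n / 2 - (c + l / 2)) with ((u n - l) * / 2) by lra.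
  rewrite Rabs_mult, (Rabs_pos_eq (/ 2)) by lra. lra.
Qed.

Local Lemma ury_fun_in A B x : ury_mid A B x -> ury_fun A B x = ury_fun A (ury_mid A B) x / 2.
Proof.
  intros Hx. apply (UL_sequence (fun n => urysohn_approx n A B x)); [apply ury_fun_cv|].
  replace (ury_fun A (ury_mid A B) x / 2) with (0 + ury_fun A (ury_mid A B) x / 2) by lra.
  apply (cv_affine (fun n => urysohn_approx n A (ury_mid A B) x)); [|apply ury_fun_cv].
  intros n. simpl. destruct excluded_middle_informative; [lra|tauto].
Qed.

Local Lemma ury_fun_out A B x : ~ ury_mid A B x -> ury_fun A B x = 1 / 2 + ury_fun (ury_mid A B) B x / 2.
Proof.
  intros Hx. apply (UL_sequence (fun n => urysohn_approx n A B x)); [apply ury_fun_cv|].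
  apply (cv_affine (fun n => urysohn_approx n (ury_mid A B) B x)); [|apply ury_fun_cv].
  intros n. simpl. destruct excluded_middle_informative; [tauto|lra].
Qed.

(** Every intermediate set met on the lower side contains a whole neighbourhood of a point of
    [cl A], so near that point the first [k] digits are 0. *)
Local Lemma ury_fun_small k : forall A B x, ll A B -> cl op A x ->
  exists O, op O /\ O x /\ forall y, O y -> ury_fun A B y <= / 2 ^ k.
Proof.
  induction k as [|k IH]; intros A B x HAB Hx.
  - exists (fun _ => True). split; [apply (op_true op HT)|]. split; [exact I|]. intros y _.
    simpl. rewrite Rinv_1. apply ury_fun_bounds.
  - destruct (ury_mid_spec A B HAB) as [H1 H2].
    destruct (IH A (ury_mid A B) x H1 Hx) as [O [HO [Ox HOF]]].
    destruct (ll_interior _ _ H1 x Hx) as [P [HP [Px HPm]]].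
    exists (fun y => O y /\ P y). split; [apply (op_and op HT); auto|]. split; [auto|].
    intros y [Oy Py]. rewrite (ury_fun_in A B y (HPm y Py)). specialize (HOF y Oy).
    simpl. rewrite Rinv_mult. lra.
Qed.

(** Dually, a point not interior to [B] is outside the closure of each intermediate set met on the
    upper side, so nearby the first [k] digits are 1. *)
Local Lemma ury_fun_large k : forall A B x, ll A B ->
  ~ (exists O, op O /\ O x /\ forall y, O y -> B y) ->
  exists O, op O /\ O x /\ forall y, O y -> 1 - / 2 ^ k <= ury_fun A B y.
Proof.
  induction k as [|k IH]; intros A B x HAB Hx.
  - exists (fun _ => True). split; [apply (op_true op HT)|]. split; [exact I|]. intros y _.
    simpl. rewrite Rinv_1. pose proof (ury_fun_bounds A B y). lra.
  - destruct (ury_mid_spec A B HAB) as [H1 H2].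
    destruct (IH (ury_mid A B) B x H2 Hx) as [O [HO [Ox HOF]]].
    exists (fun y => O y /\ ~ cl op (ury_mid A B) y).
    split; [apply (op_and op HT); [exact HO|apply (op_not_cl op HT)]|].
    split; [split; [exact Ox|intros Hc; exact (Hx (ll_interior _ _ H2 x Hc))]|].
    intros y [Oy Hy]. rewrite (ury_fun_out A B y).
    + specialize (HOF y Oy). simpl. rewrite Rinv_mult. lra.
    + intros Hm. apply Hy, (cl_incl op), Hm.
Qed.

(** Each bisection halves the oscillation, so induction applies when [x] is interior to the
    intermediate set or outside its closure. At a boundary point both sides occur nearby: there the
    lower half is close to its maximum and the upper half close to its minimum, and both give values
    near 1/2. *)
Local Lemma ury_fun_near k : forall A B x, ll A B ->
  exists O, op O /\ O x /\ forall y, O y -> Rabs (ury_fun A B y - ury_fun A B x) <= / 2 ^ k.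
Proof.
  induction k as [|k IH]; intros A B x HAB.
  - exists (fun _ => True). split; [apply (op_true op HT)|]. split; [exact I|]. intros y _.
    simpl. rewrite Rinv_1. pose proof (ury_fun_bounds A B y). pose proof (ury_fun_bounds A B x).
    unfold Rabs; destruct Rcase_abs; lra.
  - destruct (ury_mid_spec A B HAB) as [H1 H2].
    destruct (classic (exists O, op O /\ O x /\ forall y, O y -> ury_mid A B y)) as [Hi|Hi].
    + destruct Hi as [P [HP [Px HPm]]]. destruct (IH A (ury_mid A B) x H1) as [O [HO [Ox HOF]]].
      exists (fun y => O y /\ P y). split; [apply (op_and op HT); auto|]. split; [auto|].
      intros y [Oy Py]. rewrite (ury_fun_in A B y), (ury_fun_in A B x) by auto.
      specialize (HOF y Oy).
      simpl. rewrite Rinv_mult. revert HOF. unfold Rabs; repeat destruct Rcase_abs; lra.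
    + destruct (classic (cl op (ury_mid A B) x)) as [Hc|Hc].
      * destruct (ury_fun_small (S k) _ B x H2 Hc) as [O [HO [Ox HOF]]].
        destruct (ury_fun_large (S k) A _ x H1 Hi) as [P [HP [Px HPF]]].
        exists (fun y => O y /\ P y). split; [apply (op_and op HT); auto|]. split; [auto|].
        assert (Hy : forall y, O y /\ P y ->
          1 / 2 - / 2 ^ S k / 2 <= ury_fun A B y <= 1 / 2 + / 2 ^ S k / 2).
        { intros y [Oy Py]. pose proof (HOF y Oy). pose proof (HPF y Py).
          pose proof (ury_fun_bounds A (ury_mid A B) y).
          pose proof (ury_fun_bounds (ury_mid A B) B y).
          destruct (classic (ury_mid A B y));
            [rewrite ury_fun_in by auto|rewrite ury_fun_out by auto]; lra. }
        intros y Oy. pose proof (Hy y Oy). pose proof (Hy x (conj Ox Px)).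
        unfold Rabs; destruct Rcase_abs; lra.
      * destruct (IH (ury_mid A B) B x H2) as [O [HO [Ox HOF]]].
        exists (fun y => O y /\ ~ cl op (ury_mid A B) y).
        split; [apply (op_and op HT); [exact HO|apply (op_not_cl op HT)]|].
        split; [auto|]. intros y [Oy Hy].
        rewrite (ury_fun_out A B y) by (intros Hm; apply Hy, (cl_incl op), Hm).
        rewrite (ury_fun_out A B x) by (intros Hm; apply Hc, (cl_incl op), Hm).
        specialize (HOF y Oy). simpl. rewrite Rinv_mult.
        revert HOF. unfold Rabs; repeat destruct Rcase_abs; lra.
Qed.

Local Lemma inv_pow2_small eps : 0 < eps -> exists k, / 2 ^ k < eps.
Proof.
  intros He. destruct (pow_lt_1_zero (/ 2)) with (y := eps) as [N HN]; auto.
  - rewrite Rabs_pos_eq; lra.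
  - exists N. specialize (HN N (Nat.le_refl N)). rewrite pow_inv in HN.
    rewrite Rabs_pos_eq in HN; auto. left. apply Rinv_0_lt_compat, pow_lt. lra.
Qed.

Lemma urysohn A B : ll A B ->
  exists f : X -> R, continuous op R_top f /\ (forall x, A x -> f x = 0) /\
    (forall x, ~ B x -> f x = 1) /\ (forall x, 0 <= f x <= 1).
Proof.
  intros HAB. exists (ury_fun A B). split; [|split; [|split]].
  - intros V HV. apply (op_local op HT). intros x Vx.
    destruct (HV _ Vx) as [eps [He H]]. destruct (inv_pow2_small eps He) as [k Hk].
    destruct (ury_fun_near k A B x HAB) as [O [HO [Ox HOF]]].
    exists O. repeat split; auto. intros y Oy. apply H. specialize (HOF y Oy). lra.
  - intros x Ax. apply NNPP. intros Hne. pose proof (ury_fun_bounds A B x).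
    destruct (inv_pow2_small (ury_fun A B x)) as [k Hk]; [lra|].
    destruct (ury_fun_small k A B x HAB (cl_incl op A x Ax)) as [O [_ [Ox H']]].
    specialize (H' x Ox). lra.
  - intros x Bx. apply NNPP. intros Hne. pose proof (ury_fun_bounds A B x).
    destruct (inv_pow2_small (1 - ury_fun A B x)) as [k Hk]; [lra|].
    destruct (ury_fun_large k A B x HAB) as [O [_ [Ox H']]].
    { intros [O [_ [Ox H']]]. auto. }
    specialize (H' x Ox). lra.
  - apply ury_fun_bounds.
Qed.

End Urysohn.

(** The Urysohn relation is uniform: [A N] lies in [B] for some invariant [N]. Halving [N] to [N']
    interpolates by the set [A N']. *)
Lemma topological_group_completely_regular {G : Type} {op : (G -> Prop) -> Prop}
  {m : G -> G -> G} {e : G} {inv : G -> G} (HTG : topological_group op m e inv)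
  (HC : forall u : nat -> G, exists x, cluster op u x) (U : G -> Prop) (x : G) :
  op U -> U x ->
  exists f : G -> R, continuous op R_top f /\ f x = 0 /\ (forall y, ~ U y -> f y = 1) /\
    (forall y, 0 <= f y <= 1).
Proof.
  intros HU Ux. assert (HT := proj1 HTG). assert (Hg := proj1 (proj2 (proj2 HTG))).
  destruct (urysohn op HT
    (fun A B => exists N, inv_nbhd (op := op) (m := m) (e := e) (inv := inv) N /\
       forall a b, A a -> N (m (inv a) b) -> B b))
    with (A := fun y => y = x) (B := U) as [f [H1 [H2 [H3 H4]]]].
  - intros A B [N [HN HAB]]. destruct (inv_nbhd_half HTG HC N HN) as [N' [HN' [_ HNN]]].
    exists (fun y => exists a, A a /\ N' (m (inv a) y)). split; exists N'; split; auto.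
    + intros a b Aa Nb. eauto.
    + intros a b [c [Ac Nc]] Nb. apply (HAB c); auto.
      specialize (HNN _ _ Nc Nb). grp Hg in HNN. exact HNN.
  - intros A B [N [HN HAB]] y Hy.
    destruct (inv_nbhd_half HTG HC N HN) as [N' [HN' [_ HNN]]].
    exists (fun w => N' (m (inv y) w)). split; [exact (inv_nbhd_translate HTG N' y HN')|].
    split; [grp Hg; apply HN'|].
    intros w Hw. destruct (Hy _ (inv_nbhd_translate HTG N' y HN')) as [a [Na Aa]].
    { grp Hg. apply HN'. }
    apply (HAB a); auto. destruct HN' as [_ [_ [Hs _]]].
    specialize (HNN _ _ (Hs _ Na) Hw). grp Hg in HNN. exact HNN.
  - destruct (inv_nbhd_inside HTG HC U x HU Ux) as [N [HN H]].
    exists N. split; auto. intros a b -> Hb. auto.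
  - exists f. auto.
Qed.

(** * The completion of a countably compact topological group *)

(** The ultrafilter lemma starts from a proper filter, so [F] is first closed under finite
    intersections and supersets; the hypothesis on lists is what makes the result proper. *)
Lemma ultrafilter_extension {T : Type} (F : (T -> Prop) -> Prop) :
  (forall l, (forall A, In A l -> F A) -> exists x, forall A, In A l -> A x) ->
  exists Phi : (T -> Prop) -> Prop,
    (forall A B, Phi A -> (forall x, A x -> B x) -> Phi B) /\
    (forall A B, Phi A -> Phi B -> Phi (fun x => A x /\ B x)) /\
    (forall A, Phi A -> exists x, A x) /\
    (forall A, F A -> Phi A) /\
    (forall A, Phi A \/ Phi (fun x => ~ A x)).
Proof.
  intros HF.
  pose (F' := fun B : T -> Prop => exists l, (forall A, In A l -> F A) /\
    forall x, (forall A, In A l -> A x) -> B x).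
  assert (HF' : @filter.ProperFilter T F').
  { split.
    - intros [l [Hl H]]. destruct (HF l Hl) as [x Hx]. exact (H x Hx).
    - split.
      + exists nil. split; [intros A []|]. intros; exact Logic.I.
      + intros A B [l [Hl HA]] [k [Hk HB]]. exists (l ++ k). split.
        * intros C HC. apply in_app_or in HC. destruct HC; auto.
        * intros x Hx. split; [apply HA|apply HB]; intros C HC; apply Hx, in_or_app; auto.
      + intros A B HAB [l [Hl HA]]. exists l. split; [exact Hl|].
        intros x Hx. apply HAB, HA, Hx. }
  destruct (filter.ultraFilterLemma HF') as [Phi [HU Hsub]].
  pose proof (filter.ultra_proper (F := Phi)) as HP.
  destruct HP as [H0 [_ HI HS]].
  exists Phi. split; [|split; [|split; [|split]]].
  - intros A B HA HAB. exact (HS A B HAB HA).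
  - intros A B HA HB. exact (HI A B HA HB).
  - intros A HA. apply NNPP. intros Hn. apply H0. revert HA. apply HS.
    intros x Ax. apply Hn. exists x. exact Ax.
  - intros A HA. apply Hsub. exists (A :: nil). split.
    + intros B [<-|[]]. exact HA.
    + intros x Hx. apply Hx. left; reflexivity.
  - intros A. exact (filter.in_ultra_setVsetC A HU).
Qed.

Section Completion.
Context {G : Type} {op : (G -> Prop) -> Prop} {m : G -> G -> G} {e : G} {inv : G -> G}.

Notation nbhd := (inv_nbhd (op := op) (m := m) (e := e) (inv := inv)).

(** The product set [A N], that is, the uniform enlargement of [A]. *)
Definition thicken (A N : G -> Prop) : G -> Prop := fun x => exists a, A a /\ N (m (inv a) x).

(* The points of the completion are the minimal Cauchy filters. *)
Definition round_cauchy (xi : (G -> Prop) -> Prop) : Prop :=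
  (forall A B, xi A -> (forall x, A x -> B x) -> xi B) /\
  (forall A B, xi A -> xi B -> xi (fun x => A x /\ B x)) /\
  (forall A, xi A -> exists x, A x) /\
  (forall A, xi A -> exists P N, xi P /\ nbhd N /\ forall x, thicken P N x -> A x) /\
  (forall N, nbhd N -> exists g, xi (fun x => N (m (inv g) x))).

Definition completion : Type := {xi | round_cauchy xi}.

Definition mem (xi : completion) (A : G -> Prop) : Prop := proj1_sig xi A.

Definition completion_open (U : completion -> Prop) : Prop :=
  forall xi, U xi -> exists A, mem xi A /\ forall eta, mem eta A -> U eta.

Lemma mem_up (xi : completion) (A B : G -> Prop) :
  mem xi A -> (forall x, A x -> B x) -> mem xi B.
Proof. apply (proj2_sig xi). Qed.
Lemma mem_and (xi : completion) (A B : G -> Prop) :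
  mem xi A -> mem xi B -> mem xi (fun x => A x /\ B x).
Proof. apply (proj2_sig xi). Qed.
Lemma mem_inhabited (xi : completion) (A : G -> Prop) : mem xi A -> exists x, A x.
Proof. apply (proj2_sig xi). Qed.
Lemma mem_round (xi : completion) (A : G -> Prop) : mem xi A ->
  exists P N, mem xi P /\ nbhd N /\ forall x, thicken P N x -> A x.
Proof. apply (proj2_sig xi). Qed.
Lemma mem_cauchy (xi : completion) N : nbhd N -> exists g, mem xi (fun x => N (m (inv g) x)).
Proof. apply (proj2_sig xi). Qed.

Hypothesis HTG : topological_group op m e inv.
Hypothesis HC : forall u : nat -> G, exists x, cluster op u x.

Lemma completion_is_topology : is_topology completion_open.
Proof.
  split; [|split].
  - intros xi _. destruct (inv_nbhd_exists HTG HC) as [N HN].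
    destruct (mem_cauchy xi N HN) as [g Hxi]. eauto.
  - intros U V HU HV xi [Ux Vx].
    destruct (HU xi Ux) as [A [HA HAU]]. destruct (HV xi Vx) as [B [HB HBV]].
    exists (fun x => A x /\ B x). split; [apply mem_and; auto|].
    intros eta H. split; [apply HAU|apply HBV]; apply (mem_up eta _ _ H); tauto.
  - intros F HF xi [U [FU Ux]]. destruct (HF U FU xi Ux) as [A [HA HAU]].
    exists A. split; auto. intros eta H. exists U. auto.
Qed.

Lemma completion_open_mem A : completion_open (fun xi => mem xi A).
Proof. intros xi H. exists A. auto. Qed.

(** The minimality of round Cauchy filters. With [P N] inside [B], a member [g N'] of [xi] meets [P]
    in some [x]; all of [g N'] then lies in [x N' N'], hence in [P N] and in [B]. *)
Lemma mem_of_meet (xi eta : completion) :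
  (forall A B, mem xi A -> mem eta B -> exists x, A x /\ B x) ->
  forall B, mem eta B -> mem xi B.
Proof.
  intros H B HB. destruct (mem_round eta B HB) as [P [N [HP [HN HPN]]]].
  destruct (inv_nbhd_half HTG HC N HN) as [N' [HN' [_ HNN]]].
  destruct (mem_cauchy xi N' HN') as [g Hgxi].
  destruct (H _ _ Hgxi HP) as [x [Nx Px]].
  apply (mem_up xi _ _ Hgxi). intros y Ny. apply HPN. exists x. split; auto.
  specialize (HNN _ _ (proj1 (proj2 (proj2 HN')) _ Nx) Ny). grp (tg_group HTG) in HNN. exact HNN.
Qed.

Lemma completion_eq_of_meet (xi eta : completion) :
  (forall A B, mem xi A -> mem eta B -> exists x, A x /\ B x) -> xi = eta.
Proof.
  intros H. assert (E : proj1_sig xi = proj1_sig eta).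
  { apply functional_extensionality. intros A. apply propositional_extensionality. split.
    - apply mem_of_meet. intros A' B' HA HB. destruct (H B' A' HB HA) as [x Hx].
      exists x. tauto.
    - apply mem_of_meet. exact H. }
  destruct xi as [xi Hxi], eta as [eta Heta]. simpl in E. subst eta.
  f_equal. apply proof_irrelevance.
Qed.

(** Minimal filters admit no proper inclusion, so each identity in the completion is checked by one
    inclusion. *)
Lemma completion_eq_of_subset (xi eta : completion) :
  (forall A, mem xi A -> mem eta A) -> xi = eta.
Proof.
  intros H. apply completion_eq_of_meet. intros A B HA HB.
  apply (mem_inhabited eta). apply mem_and; auto.
Qed.

Lemma completion_hausdorff : hausdorff completion_open.
Proof.
  intros xi eta Hne.
  assert (H : exists A B, mem xi A /\ mem eta B /\ forall x, ~ (A x /\ B x)).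
  { apply NNPP. intros H. apply Hne, completion_eq_of_meet. intros A B HA HB.
    apply NNPP. intros Hx. apply H. exists A, B. repeat split; auto.
    intros x Hx'. apply Hx. eauto. }
  destruct H as [A [B [HA [HB Hd]]]].
  exists (fun zeta => mem zeta A), (fun zeta => mem zeta B).
  split; [apply completion_open_mem|split; [apply completion_open_mem|]].
  split; [exact HA|split; [exact HB|]].
  intros zeta [H1 H2]. destruct (mem_inhabited zeta _ (mem_and zeta _ _ H1 H2)) as [x Hx].
  exact (Hd x Hx).
Qed.

Lemma round_cauchy_principal g :
  round_cauchy (fun A => exists N, nbhd N /\ forall x, N (m (inv g) x) -> A x).
Proof.
  split; [|split; [|split; [|split]]].
  - intros A B [N [HN HA]] HAB. exists N. auto.
  - intros A B [N [HN HA]] [N' [HN' HB]]. exists (fun x => N x /\ N' x).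
    split; [apply (inv_nbhd_and HTG); auto|]. intros x [H1 H2]. auto.
  - intros A [N [HN HA]]. exists g. apply HA. grp (tg_group HTG). apply HN.
  - intros A [N [HN HA]]. destruct (inv_nbhd_half HTG HC N HN) as [N' [HN' [_ HNN]]].
    exists (fun x => N' (m (inv g) x)), N'. split; [eauto|split; [exact HN'|]].
    intros x [a [Ha Hx]]. apply HA. specialize (HNN _ _ Ha Hx). grp (tg_group HTG) in HNN. exact HNN.
  - intros N HN. exists g, N. auto.
Qed.

Definition to_completion (g : G) : completion := exist _ _ (round_cauchy_principal g).

Lemma mem_to_completion g A : mem (to_completion g) A -> A g.
Proof. intros [N [HN H]]. apply H. grp (tg_group HTG). apply HN. Qed.

Lemma mem_to_completion_open g A : op A -> A g -> mem (to_completion g) A.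
Proof.
  intros HA Ag. destruct (inv_nbhd_inside HTG HC A g HA Ag) as [N [HN H]]. exists N. auto.
Qed.

Lemma to_completion_embedding : embedding op completion_open to_completion.
Proof.
  split; [|split].
  - intros g h E. apply NNPP. intros Hne.
    apply (mem_to_completion h (fun x => x <> h)); [|reflexivity].
    rewrite <- E. apply mem_to_completion_open; auto.
    apply (hausdorff_op_neq op (proj1 HTG)), HTG.
  - intros U HU. apply (op_local op (proj1 HTG)). intros g Ug.
    destruct (HU _ Ug) as [A [[N [HN HNA]] HAU]].
    destruct (inv_nbhd_half HTG HC N HN) as [N' [HN' [_ HNN]]].
    exists (fun x => N' (m (inv g) x)).
    split; [exact (inv_nbhd_translate HTG N' g HN')|split; [grp (tg_group HTG); apply HN'|]].
    intros x Hx. apply HAU. exists N'. split; auto. intros y Hy. apply HNA.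
    specialize (HNN _ _ Hx Hy). grp (tg_group HTG) in HNN. exact HNN.
  - intros V HV. exists (fun xi => mem xi V). split; [apply completion_open_mem|].
    intros g. split; [apply mem_to_completion_open; exact HV|apply mem_to_completion].
Qed.

Lemma to_completion_dense : dense completion_open (fun xi => exists g, xi = to_completion g).
Proof.
  intros U HU [xi Ux]. destruct (HU xi Ux) as [A [HA HAU]].
  destruct (mem_round xi A HA) as [P [N [HP [HN HPN]]]].
  destruct (mem_inhabited xi P HP) as [p Pp].
  exists (to_completion p). split; [|eauto]. apply HAU. exists N. split; auto.
  intros x Hx. apply HPN. exists p. auto.
Qed.

(** The thickened members of a Cauchy filter form the minimal Cauchy filter below it. This turns the
    ultrafilter of the compactness proof into a point. *)
Lemma round_cauchy_envelope (Phi : (G -> Prop) -> Prop) :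
  (forall A B, Phi A -> Phi B -> Phi (fun x => A x /\ B x)) ->
  (forall A, Phi A -> exists x, A x) ->
  (forall N, nbhd N -> exists g, Phi (fun x => N (m (inv g) x))) ->
  round_cauchy (fun A => exists P N, Phi P /\ nbhd N /\ forall x, thicken P N x -> A x).
Proof.
  intros HI H0 HcPhi. split; [|split; [|split; [|split]]].
  - intros A B [P [N [HP [HN HA]]]] HAB. exists P, N. auto.
  - intros A B [P [N [HP [HN HA]]]] [Q [M [HQ [HM HB]]]].
    exists (fun x => P x /\ Q x), (fun x => N x /\ M x).
    split; [auto|split; [apply (inv_nbhd_and HTG); auto|]].
    intros x [a [[Pa Qa] [Na Ma]]]. split; [apply HA|apply HB]; exists a; auto.
  - intros A [P [N [HP [HN HA]]]]. destruct (H0 P HP) as [p Pp]. exists p. apply HA.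
    exists p. split; auto. grp (tg_group HTG). apply HN.
  - intros A [P [N [HP [HN HA]]]]. destruct (inv_nbhd_half HTG HC N HN) as [N' [HN' [_ HNN]]].
    exists (thicken P N'), N'. split; [exists P, N'; auto|split; [exact HN'|]].
    intros x [a [[p [Pp Ha]] Hx]]. apply HA. exists p. split; auto.
    specialize (HNN _ _ Ha Hx). grp (tg_group HTG) in HNN. exact HNN.
  - intros N HN. destruct (inv_nbhd_half HTG HC N HN) as [N' [HN' [_ HNN]]].
    destruct (HcPhi N' HN') as [g Hgp]. exists g, (fun x => N' (m (inv g) x)), N'.
    split; [auto|split; [auto|]]. intros x [a [Ha Hx]].
    specialize (HNN _ _ Ha Hx). grp (tg_group HTG) in HNN. exact HNN.
Qed.

(** A set [P] is small if some [P N] forces a filter containing it into one member of the cover. If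
    finitely many small sets cover [G], a common [N] yields the subcover. Otherwise some ultrafilter
    contains the complements of all small sets; by precompactness it is Cauchy, its envelope lies in
    a member of the cover, and so one of its own sets is small. *)
Lemma completion_compact : compact_space completion_open.
Proof.
  intros F HF Hcov.
  pose (small := fun P : G -> Prop => exists N, nbhd N /\ exists U, F U /\
    forall eta, mem eta (thicken P N) -> U eta).
  assert (Hfin : forall l, (forall P, In P l -> small P) -> exists N lu, nbhd N /\
    (forall U, In U lu -> F U) /\ forall P, In P l -> exists U, In U lu /\
    forall eta, mem eta (thicken P N) -> U eta).
  { induction l as [|P l IH]; intros Hl.
    - destruct (inv_nbhd_exists HTG HC) as [N HN]. exists N, nil.
      split; [auto|split]; intros ? [].
    - destruct IH as [N [lu [HN [Hlu H]]]]; [intros; apply Hl; right; auto|].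
      destruct (Hl P) as [N' [HN' [U [FU HU]]]]; [left; auto|].
      exists (fun x => N x /\ N' x), (U :: lu).
      split; [apply (inv_nbhd_and HTG); auto|split].
      + intros V [<-|HV]; auto.
      + intros Q [<-|HQ].
        * exists U. split; [left; auto|]. intros eta He. apply HU, (mem_up eta _ _ He).
          intros x [a [Pa [_ Na]]]. exists a. auto.
        * destruct (H Q HQ) as [V [HV HV']]. exists V. split; [right; auto|].
          intros eta He. apply HV', (mem_up eta _ _ He).
          intros x [a [Pa [Na _]]]. exists a. auto. }
  destruct (classic (exists l, (forall P, In P l -> small P) /\
    forall x, exists P, In P l /\ P x)) as [[l [Hl Hlc]]|Hno].
  - destruct (Hfin l Hl) as [N [lu [HN [Hlu H]]]]. exists lu. split; [exact Hlu|].
    intros xi _. destruct (mem_cauchy xi N HN) as [g Hxi]. destruct (Hlc g) as [P [HP Pg]].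
    destruct (H P HP) as [U [HU HPU]]. exists U. split; [exact HU|]. apply HPU.
    apply (mem_up xi _ _ Hxi). intros x Hx. exists g. auto.
  - exfalso.
    destruct (ultrafilter_extension (fun Q : G -> Prop => small (fun x => ~ Q x)))
      as [Phi [Hup [HI [H0 [Hsub HUl]]]]].
    { intros l Hl. apply NNPP. intros Hx. apply Hno.
      exists (map (fun (Q : G -> Prop) x => ~ Q x) l). split.
      - intros P HP. apply in_map_iff in HP. destruct HP as [Q [<- HQ]]. auto.
      - intros x. apply NNPP. intros Hx'. apply Hx. exists x. intros Q HQ.
        apply NNPP. intros HQx. apply Hx'. exists (fun x => ~ Q x). split; [|exact HQx].
        apply (in_map (fun (Q : G -> Prop) x => ~ Q x)), HQ. }
    (* Pigeonhole: when finitely many sets cover a member of an ultrafilter, one of them is a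
       member. *)
    assert (Hfu : forall (T : Type) (Q : T -> G -> Prop) (l : list T) (A : G -> Prop),
      Phi A -> (forall x, A x -> exists t, In t l /\ Q t x) -> exists t, In t l /\ Phi (Q t)).
    { intros T Q. induction l as [|t l IH]; intros A HA Hl.
      - destruct (H0 A HA) as [x Ax]. destruct (Hl x Ax) as [t [[] _]].
      - destruct (HUl (Q t)) as [Ht|Ht]; [exists t; split; [left; auto|exact Ht]|].
        destruct (IH _ (HI _ _ HA Ht)) as [s [Hs HPs]].
        + intros x [Ax Hx]. destruct (Hl x Ax) as [s [[<-|Hs] Qs]]; [tauto|eauto].
        + exists s. split; [right; auto|exact HPs]. }
    assert (Htrue : Phi (fun _ => True)).
    { destruct (HUl (fun _ => True)) as [H|H]; [exact H|]. apply (Hup _ _ H). auto. }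
    assert (Hcau : forall N, nbhd N -> exists g, Phi (fun x => N (m (inv g) x))).
    { intros N HN.
      destruct (countably_compact_precompact HTG HC N) as [l Hl]; try apply HN.
      destruct (Hfu G (fun g x => N (m (inv g) x)) l _ Htrue) as [g [_ Hgp]]; eauto. }
    pose (xi := exist _ _ (round_cauchy_envelope Phi HI H0 Hcau) : completion).
    destruct (Hcov xi I) as [U [FU Ux]]. destruct (HF U FU xi Ux) as [A [HA HAU]].
    destruct HA as [P [N [HP [HN HPN]]]].
    assert (HnP : Phi (fun x => ~ P x)).
    { apply Hsub. exists N. split; [exact HN|]. exists U. split; [exact FU|].
      intros eta He. apply HAU, (mem_up eta _ _ He). intros x [a [Pa Na]]. apply HPN.
      exists a. split; [apply NNPP, Pa|exact Na]. }
    destruct (H0 _ (HI _ _ HP HnP)) as [x Hx]. tauto.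
Qed.

(** The extra factor [N] in [A B N] gives roundness by halving. For the Cauchy property,
    [(g s)(h t) n = g h (h^-1 s h) t n], and invariance keeps the conjugate of [s] small. *)
Lemma round_cauchy_mul (xi eta : completion) :
  round_cauchy (fun C => exists A B N, mem xi A /\ mem eta B /\ nbhd N /\
    forall a b n, A a -> B b -> N n -> C (m a (m b n))).
Proof.
  split; [|split; [|split; [|split]]].
  - intros C D [A [B [N [HA [HB [HN H]]]]]] HCD. exists A, B, N. auto 10.
  - intros C D [A [B [N [HA [HB [HN H]]]]]] [A' [B' [N' [HA' [HB' [HN' H']]]]]].
    exists (fun x => A x /\ A' x), (fun x => B x /\ B' x), (fun x => N x /\ N' x).
    split; [apply mem_and; auto|split; [apply mem_and; auto|]].
    split; [apply (inv_nbhd_and HTG); auto|]. intros a b n [] [] []. auto.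
  - intros C [A [B [N [HA [HB [HN H]]]]]].
    destruct (mem_inhabited _ _ HA) as [a Aa]. destruct (mem_inhabited _ _ HB) as [b Bb].
    exists (m a (m b e)). apply H; auto. apply HN.
  - intros C [A [B [N [HA [HB [HN H]]]]]].
    destruct (inv_nbhd_half HTG HC N HN) as [N' [HN' [_ HNN]]].
    exists (fun x => exists a b n, A a /\ B b /\ N' n /\ x = m a (m b n)), N'.
    split; [exists A, B, N'; eauto 10|split; [exact HN'|]].
    intros x [y [[a [b [n [Aa [Bb [Nn ->]]]]]] Hx]].
    specialize (H a b _ Aa Bb (HNN _ _ Nn Hx)). grp (tg_group HTG) in H. exact H.
  - intros N HN.
    destruct (inv_nbhd_half HTG HC N HN) as [N1 [HN1 [_ HNN1]]].
    destruct (inv_nbhd_half HTG HC N1 HN1) as [N2 [HN2 [HN21 HNN2]]].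
    destruct (mem_cauchy xi N2 HN2) as [g Hxi]. destruct (mem_cauchy eta N2 HN2) as [h Heta].
    exists (m g h), (fun x => N2 (m (inv g) x)), (fun x => N2 (m (inv h) x)), N2.
    repeat (split; [assumption|]).
    intros a b n Ha Hb Hn.
    pose proof (HNN1 _ _ (HN21 _ (proj2 (proj2 (proj2 HN2)) (inv h) _ Ha)) (HNN2 _ _ Hb Hn))
      as H.
    grp (tg_group HTG) in H. grp (tg_group HTG). exact H.
Qed.

Definition completion_mul (xi eta : completion) : completion :=
  exist _ _ (round_cauchy_mul xi eta).

(** Inversion turns [P N] into [N P^-1]; conjugation invariance moves the small factor back to the
    right. *)
Lemma round_cauchy_inv (xi : completion) : round_cauchy (fun C => mem xi (fun x => C (inv x))).
Proof.
  split; [|split; [|split; [|split]]].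
  - intros A B HA HAB. apply (mem_up xi _ _ HA). auto.
  - intros A B. apply (mem_and xi).
  - intros A HA. destruct (mem_inhabited xi _ HA) as [x Hx]. eauto.
  - intros A HA. destruct (mem_round xi _ HA) as [P [N [HP [HN HPN]]]].
    exists (fun x => P (inv x)), N. split; [|split; [exact HN|]].
    + apply (mem_up xi _ _ HP). intros x Px. grp (tg_group HTG). exact Px.
    + intros x [a [Pa Na]]. rewrite <- (g_VV (tg_group HTG) x). apply HPN. exists (inv a).
      split; auto. grp (tg_group HTG). apply (inv_nbhd_comm HTG N _ _ HN).
      pose proof (proj1 (proj2 (proj2 HN)) _ Na) as H. grp (tg_group HTG) in H. exact H.
  - intros N HN. destruct (mem_cauchy xi N HN) as [g Hxi]. exists (inv g).
    apply (mem_up xi _ _ Hxi). intros x Hx. grp (tg_group HTG).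
    apply (inv_nbhd_comm HTG N _ _ HN).
    pose proof (proj1 (proj2 (proj2 HN)) _ Hx) as H. grp (tg_group HTG) in H. exact H.
Qed.

Definition completion_inv (xi : completion) : completion := exist _ _ (round_cauchy_inv xi).

Lemma to_completion_mul g h :
  to_completion (m g h) = completion_mul (to_completion g) (to_completion h).
Proof.
  apply completion_eq_of_subset. intros C [N [HN H]].
  destruct (inv_nbhd_half HTG HC N HN) as [N1 [HN1 [_ HNN1]]].
  destruct (inv_nbhd_half HTG HC N1 HN1) as [N2 [HN2 [HN21 HNN2]]].
  exists (fun x => N2 (m (inv g) x)), (fun x => N2 (m (inv h) x)), N2.
  split; [exists N2; auto|split; [exists N2; auto|split; [exact HN2|]]].
  intros a b n Ha Hb Hn. apply H.
  pose proof (HNN1 _ _ (HN21 _ (proj2 (proj2 (proj2 HN2)) (inv h) _ Ha)) (HNN2 _ _ Hb Hn))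
    as H'.
  grp (tg_group HTG) in H'. grp (tg_group HTG). exact H'.
Qed.

Lemma completion_is_group : is_group completion_mul (to_completion e) completion_inv.
Proof.
  split.
  - intros xi eta zeta. apply completion_eq_of_subset.
    intros C [A [D [N [HA [[B [E [M [HB [HE [HM HD]]]]]] [HN HC']]]]]].
    exists (fun x => exists a b n, A a /\ B b /\ M n /\ x = m a (m b n)), E, N.
    split; [exists A, B, M; eauto 10|split; [exact HE|split; [exact HN|]]].
    intros x c n [a [b [k [Aa [Bb [Mk ->]]]]]] Ec Nn.
    pose proof (HC' a _ n Aa (HD b c _ Bb Ec (proj2 (proj2 (proj2 HM)) (inv c) k Mk)) Nn) as H.
    grp (tg_group HTG) in H. grp (tg_group HTG). exact H.
  - intros xi. split; [|split; [|split]].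
    + symmetry. apply completion_eq_of_subset. intros C HCx.
      destruct (mem_round xi C HCx) as [P [N [HP [HN HPN]]]].
      destruct (inv_nbhd_half HTG HC N HN) as [N' [HN' [_ HNN]]].
      exists N', P, N'. split; [exists N'; split; [exact HN'|intros x; grp (tg_group HTG); auto]|].
      split; [exact HP|split; [exact HN'|]]. intros a p n Ha Pp Hn. apply HPN.
      exists p. split; auto.
      pose proof (HNN _ _ (proj2 (proj2 (proj2 HN')) (inv p) a Ha) Hn) as H.
      grp (tg_group HTG) in H. exact H.
    + symmetry. apply completion_eq_of_subset. intros C HCx.
      destruct (mem_round xi C HCx) as [P [N [HP [HN HPN]]]].
      destruct (inv_nbhd_half HTG HC N HN) as [N' [HN' [_ HNN]]].
      exists P, N', N'. split; [exact HP|].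
      split; [exists N'; split; [exact HN'|intros x; grp (tg_group HTG); auto]|split; [exact HN'|]].
      intros p a n Pp Ha Hn. apply HPN. exists p. split; auto. grp (tg_group HTG). auto.
    + symmetry. apply completion_eq_of_subset. intros C [N [HN HCx]].
      destruct (inv_nbhd_half HTG HC N HN) as [N1 [HN1 [_ HNN1]]].
      destruct (inv_nbhd_half HTG HC N1 HN1) as [N2 [HN2 [HN21 HNN2]]].
      destruct (mem_cauchy xi N2 HN2) as [g Hxi].
      exists (fun x => N2 (m (inv g) (inv x))), (fun x => N2 (m (inv g) x)), N2.
      split; [apply (mem_up xi _ _ Hxi); intros x; grp (tg_group HTG); auto|].
      split; [exact Hxi|split; [exact HN2|]]. intros a b n Ha Hb Hn. apply HCx.
      pose proof (HNN1 _ _ (HN21 _ (proj1 (proj2 (proj2 HN2)) _ Ha)) (HNN2 _ _ Hb Hn)) as H.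
      grp (tg_group HTG) in H. grp (tg_group HTG). exact H.
    + symmetry. apply completion_eq_of_subset. intros C [N [HN HCx]].
      destruct (inv_nbhd_half HTG HC N HN) as [N1 [HN1 [_ HNN1]]].
      destruct (inv_nbhd_half HTG HC N1 HN1) as [N2 [HN2 [HN21 HNN2]]].
      destruct (mem_cauchy xi N2 HN2) as [g Hxi].
      exists (fun x => N2 (m (inv g) x)), (fun x => N2 (m (inv g) (inv x))), N2.
      split; [exact Hxi|].
      split; [apply (mem_up xi _ _ Hxi); intros x; grp (tg_group HTG); auto|split; [exact HN2|]].
      intros a b n Ha Hb Hn. apply HCx.
      pose proof (proj2 (proj2 (proj2 HN1)) g _
        (HNN2 _ _ Ha (proj1 (proj2 (proj2 HN2)) _ Hb))) as H1.
      pose proof (HNN1 _ _ H1 (HN21 _ Hn)) as H.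
      grp (tg_group HTG) in H. grp (tg_group HTG). exact H.
Qed.

Lemma completion_topological_group :
  topological_group completion_open completion_mul (to_completion e) completion_inv.
Proof.
  split; [apply completion_is_topology|split; [apply completion_hausdorff|]].
  split; [apply completion_is_group|split].
  - intros W HW [xi eta] Hxe. destruct (HW _ Hxe) as [C [[A [B [N [HA [HB [HN H]]]]]] HCW]].
    exists (fun z => mem z A), (fun z => mem z B).
    split; [apply completion_open_mem|split; [apply completion_open_mem|]].
    split; [exact HA|split; [exact HB|]]. intros x y Hx Hy. apply HCW. exists A, B, N. auto.
  - intros W HW xi Hxi. destruct (HW _ Hxi) as [C [HCx HCW]].
    exists (fun x => C (inv x)). split; [exact HCx|]. intros eta He. apply HCW, He.
Qed.

(** By uniform continuity [f] is nearly constant on some member of [xi]. The limit is the supremum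
    of the numbers that bound [f] from below on a member. *)
Lemma completion_limit (f : G -> R) (xi : completion) : continuous op R_top f ->
  exists r, forall eps, 0 < eps -> exists A, mem xi A /\ forall x, A x -> Rabs (f x - r) < eps.
Proof.
  intros Hf.
  assert (Hosc : forall eps, 0 < eps -> exists g,
    mem xi (fun x => Rabs (f g - f x) < eps)).
  { intros eps He.
    destruct (countably_compact_uniformly_continuous HTG HC f eps Hf He) as [N [HN H]].
    destruct (mem_cauchy xi N HN) as [g Hxi]. exists g. apply (mem_up xi _ _ Hxi). auto. }
  pose (E := fun t => mem xi (fun x => t <= f x)).
  assert (Hle : forall g eps t, mem xi (fun x => Rabs (f g - f x) < eps) -> E t ->
    t <= f g + eps).
  { intros g eps t H1 H2. destruct (mem_inhabited xi _ (mem_and xi _ _ H1 H2)) as [x [Hx Ht]].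
    apply Rabs_def2 in Hx. lra. }
  assert (Hge : forall g eps, mem xi (fun x => Rabs (f g - f x) < eps) -> E (f g - eps)).
  { intros g eps H. apply (mem_up xi _ _ H). intros x Hx. apply Rabs_def2 in Hx. lra. }
  destruct (Hosc 1 Rlt_0_1) as [g0 Hg0].
  destruct (completeness E) as [r [Hub Hlub]].
  - exists (f g0 + 1). intros t Ht. eauto.
  - exists (f g0 - 1). auto.
  - exists r. intros eps He. destruct (Hosc (eps / 2)) as [g Hgo]; [lra|].
    exists (fun x => Rabs (f g - f x) < eps / 2). split; [exact Hgo|].
    intros x Hx. pose proof (Hub _ (Hge _ _ Hgo)).
    assert (r <= f g + eps / 2) by (apply Hlub; intros t Ht; eauto).
    apply Rabs_def2 in Hx. apply Rabs_def1; lra.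
Qed.

(** The extension is the limit of [f] along the filter. A bound for [f] on a set [A] passes to the
    limit at every point having [A] as a member, which gives continuity. *)
Lemma completion_stone_cech : stone_cech op completion_open to_completion.
Proof.
  split; [apply completion_is_topology|split; [apply completion_compact|]].
  split; [apply completion_hausdorff|split; [apply to_completion_embedding|]].
  split; [apply to_completion_dense|].
  intros f Hf _.
  destruct (choice _ (fun xi => completion_limit f xi Hf)) as [g Hgl].
  assert (Hcl : forall xi A r d, mem xi A -> (forall x, A x -> Rabs (f x - r) < d) ->
    Rabs (g xi - r) <= d).
  { intros xi A r d HA H. apply Rnot_lt_le. intros Hlt.
    destruct (Hgl xi (Rabs (g xi - r) - d)) as [B [HB HBf]]; [lra|].
    destruct (mem_inhabited xi _ (mem_and xi _ _ HA HB)) as [x [Ax Bx]].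
    specialize (H x Ax). specialize (HBf x Bx).
    revert H HBf Hlt. unfold Rabs. repeat destruct Rcase_abs; lra. }
  exists g. split.
  - intros V HV xi Vxi. destruct (HV _ Vxi) as [eps [He H]].
    destruct (Hgl xi (eps / 2)) as [A [HA HAf]]; [lra|].
    exists A. split; [exact HA|]. intros eta Heta. apply H.
    specialize (Hcl eta A _ _ Heta HAf). lra.
  - intros x. apply NNPP. intros Hne.
    destruct (Hgl (to_completion x) (Rabs (f x - g (to_completion x)))) as [A [HA HAf]].
    + apply Rabs_pos_lt. lra.
    + specialize (HAf x (mem_to_completion x A HA)). lra.
Qed.

End Completion.

(** * Orthogonal sums of Brandt semigroups *)

Section OrthogonalSumAlgebra.
Context {I S : Type} {Lam G : I -> Type} {gm : forall i, G i -> G i -> G i}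
  {ge : forall i, G i} {ginv : forall i, G i -> G i} {m : S -> S -> S} {z : S}
  {E : forall i, Lam i -> G i -> Lam i -> S}.
Hypotheses (Hsum : orth_sum_decomp Lam G gm m z E)
  (HG : forall i, is_group (gm i) (ge i) (ginv i)).

Lemma os_0l x : m z x = z. Proof. apply Hsum. Qed.
Lemma os_0r x : m x z = z. Proof. apply Hsum. Qed.
Lemma os_neq0 i a g b : E i a g b <> z. Proof. apply Hsum. Qed.
Lemma os_case x : x = z \/ exists i a g b, x = E i a g b. Proof. apply Hsum. Qed.
Lemma os_inj i a g b a' g' b' : E i a g b = E i a' g' b' -> a = a' /\ g = g' /\ b = b'.
Proof. apply Hsum. Qed.
Lemma os_index i j a g b a' g' b' : E i a g b = E j a' g' b' -> i = j.
Proof.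
  intros H. apply NNPP. intros Hij. revert H. apply Hsum, Hij.
Qed.
Lemma os_mul i a g b h d : m (E i a g b) (E i b h d) = E i a (gm i g h) d.
Proof. apply Hsum. Qed.
Lemma os_mul0 i a g b c h d : b <> c -> m (E i a g b) (E i c h d) = z.
Proof. apply Hsum. Qed.
Lemma os_mul0_index i j a g b c h d : i <> j -> m (E i a g b) (E j c h d) = z.
Proof. apply Hsum. Qed.

Lemma os_mul_case i a g b y :
  m (E i a g b) y = z \/ exists h d, y = E i b h d /\ m (E i a g b) y = E i a (gm i g h) d.
Proof.
  destruct (os_case y) as [->|[j [c [h [d ->]]]]]; [left; apply os_0r|].
  destruct (classic (i = j)) as [<-|Hij]; [|left; apply os_mul0_index, Hij].
  destruct (classic (b = c)) as [<-|Hbc]; [|left; apply os_mul0, Hbc].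
  right. exists h, d. split; [reflexivity|apply os_mul].
Qed.

Lemma orth_sum_assoc : associative m.
Proof.
  intros x y w.
  destruct (os_case x) as [->|[i [a [g [b ->]]]]]; [rewrite !os_0l; reflexivity|].
  destruct (os_case y) as [->|[j [c [h [d ->]]]]]; [rewrite os_0l, os_0r, os_0l; reflexivity|].
  destruct (os_case w) as [->|[k [p [l [q ->]]]]]; [rewrite !os_0r; reflexivity|].
  destruct (classic (i = j)) as [<-|Hij].
  - destruct (classic (b = c)) as [<-|Hbc].
    + rewrite os_mul. destruct (classic (i = k)) as [<-|Hik].
      * destruct (classic (d = p)) as [<-|Hdp].
        -- rewrite !os_mul, (g_assoc (HG i)). reflexivity.
        -- rewrite !os_mul0 by assumption. apply os_0r.
      * rewrite !os_mul0_index by assumption. apply os_0r.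
    + rewrite (os_mul0 i a g b c h d Hbc), os_0l.
      destruct (os_mul_case i c h d (E k p l q)) as [->|[h' [d' [_ ->]]]]; [apply os_0r|].
      apply os_mul0, Hbc.
  - rewrite (os_mul0_index i j a g b c h d Hij), os_0l.
    destruct (os_mul_case j c h d (E k p l q)) as [->|[h' [d' [_ ->]]]]; [apply os_0r|].
    apply os_mul0_index, Hij.
Qed.

Lemma orth_sum_inverse_semigroup : inverse_semigroup m.
Proof.
  split; [exact orth_sum_assoc|]. intros x.
  destruct (os_case x) as [->|[i [a [g [b ->]]]]].
  - exists z. split; [rewrite !os_0l; auto|]. intros y [_ H]. rewrite os_0r, os_0l in H.
    exact H.
  - exists (E i b (ginv i g) a). split.
    + rewrite !os_mul. split; f_equal; grp (HG i); reflexivity.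
    + intros y [H _]. destruct (os_mul_case i a g b y) as [H0|[h [d [-> H0]]]].
      * rewrite H0, os_0l in H. destruct (os_neq0 _ _ _ _ (eq_sym H)).
      * rewrite H0 in H. destruct (os_mul_case i a (gm i g h) d (E i a g b))
          as [H1|[h' [d' [H2 H1]]]]; rewrite H1 in H.
        -- destruct (os_neq0 _ _ _ _ (eq_sym H)).
        -- apply os_inj in H2. destruct H2 as [-> [-> ->]].
           apply os_inj in H. destruct H as [_ [H _]].
           rewrite (g_assoc (HG i)) in H.
           assert (H' : gm i h h' = ge i)
             by (rewrite <- (g_Kl (HG i) h' (gm i h h')), H, (g_Vl (HG i)); reflexivity).
           apply (g_inv_unique (HG i)) in H'. rewrite H', (g_VV (HG i)). reflexivity.
Qed.

Lemma orth_sum_idempotent x : m x x = x -> x <> z -> exists i a, x = E i a (ge i) a.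
Proof.
  intros Hx Hz. destruct (os_case x) as [->|[i [a [g [b ->]]]]]; [tauto|].
  destruct (os_mul_case i a g b (E i a g b)) as [H|[h [d [H1 H2]]]]; [congruence|].
  rewrite H2 in Hx. apply os_inj in Hx. apply os_inj in H1.
  destruct Hx as [_ [Hx ->]], H1 as [<- [<- _]].
  exists i, a. f_equal. rewrite <- (g_Kl (HG i) g g), Hx. apply (g_Vl (HG i)).
Qed.

Lemma orth_sum_primitive : primitive_with_zero m z.
Proof.
  split; [intros x; rewrite os_0l, os_0r; auto|].
  intros e f He Hf Hez Hfz [H _].
  destruct (orth_sum_idempotent e He Hez) as [i [a ->]].
  destruct (orth_sum_idempotent f Hf Hfz) as [j [b ->]].
  destruct (os_mul_case i a (ge i) a (E j b (ge j) b)) as [H0|[h [d [H1 _]]]]; [congruence|].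
  pose proof (os_index _ _ _ _ _ _ _ _ H1). subst j.
  apply os_inj in H1. destruct H1 as [-> _]. reflexivity.
Qed.

End OrthogonalSumAlgebra.

(* The carrier of the orthogonal sum of the Brandt semigroups over the [Y i]; [None] is
   the zero. *)
Section BrandtSum.
Context {I : Type} {Lam Y : I -> Type}.

(** With the summand and both indices in one type, a single list expresses finiteness over all
    blocks of all summands. *)
Definition block_index : Type := {i : I & (Lam i * Lam i)%type}.
Definition blk (i : I) (a b : Lam i) : block_index := existT _ i (a, b).

Lemma blk_inj i a b a' b' : blk i a b = blk i a' b' -> a = a' /\ b = b'.
Proof.
  intros H. apply inj_pair2 in H. injection H. auto.
Qed.

Definition brandt_sum : Type := option {k : block_index & Y (projT1 k)}.
Definition bs (i : I) (a : Lam i) (y : Y i) (b : Lam i) : brandt_sum :=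
  Some (existT (fun k : block_index => Y (projT1 k)) (blk i a b) y).

Lemma bs_case (x : brandt_sum) : x = None \/ exists i a y b, x = bs i a y b.
Proof.
  destruct x as [[[i [a b]] y]|]; [right|left; reflexivity]. exists i, a, y, b. reflexivity.
Qed.

Lemma bs_index i j a y b a' y' b' : bs i a y b = bs j a' y' b' -> i = j.
Proof. intros H. exact (f_equal (fun o : brandt_sum =>
  match o with Some s => projT1 (projT1 s) | None => i end) H).
Qed.

Lemma bs_inj i a y b a' y' b' : bs i a y b = bs i a' y' b' -> a = a' /\ y = y' /\ b = b'.
Proof.
  intros H.
  assert (H1 : blk i a b = blk i a' b') by exact
    (f_equal (fun o : brandt_sum => match o with Some s => projT1 s | None => blk i a b end) H).
  apply blk_inj in H1. destruct H1 as [<- <-].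
  apply (f_equal (fun o : brandt_sum => match o with
    Some s => s
  | None => existT (fun k : block_index => Y (projT1 k)) (blk i a b) y end)) in H.
  apply inj_pair2 in H. auto.
Qed.

Context {opY : forall i, (Y i -> Prop) -> Prop}.

(* A neighbourhood of zero contains all but finitely many blocks, and zero is isolated
   from every single block. *)
Definition brandt_sum_open (U : brandt_sum -> Prop) : Prop :=
  (forall i a b, opY i (fun y => U (bs i a y b))) /\
  (U None -> exists l, forall i a b, ~ In (blk i a b) l -> forall y, U (bs i a y b)).

Section SumTopology.
Hypothesis HT : forall i, is_topology (opY i).

Lemma brandt_sum_is_topology : is_topology brandt_sum_open.
Proof.
  split; [|split].
  - split; [intros; apply op_true, HT|]. intros _. exists nil. auto.
  - intros U V [HU HU0] [HV HV0]. split.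
    + intros i a b. apply (op_and _ (HT i)); auto.
    + intros [Uz Vz]. destruct (HU0 Uz) as [l Hl]. destruct (HV0 Vz) as [l' Hl'].
      exists (l ++ l'). intros i a b Hi y. split; [apply Hl|apply Hl'];
        intros H; apply Hi, in_or_app; auto.
  - intros F HF. split.
    + intros i a b. apply (op_local _ (HT i)). intros y [U [FU Uy]].
      exists (fun y => U (bs i a y b)). split; [apply (HF U FU)|]. eauto.
    + intros [U [FU Uz]]. destruct (proj2 (HF U FU) Uz) as [l Hl].
      exists l. intros i a b Hi y. exists U. auto.
Qed.

Lemma brandt_sum_block_open i a b (V : Y i -> Prop) : opY i V ->
  brandt_sum_open (fun x => exists y, V y /\ x = bs i a y b).
Proof.
  intros HV. split.
  - intros j c d. destruct (classic (i = j)) as [<-|Hij].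
    + destruct (classic (a = c /\ b = d)) as [[<- <-]|Hac].
      * apply (op_ext _ V); [|exact HV]. intros y. split; [eauto|].
        intros [y' [Vy H]]. apply bs_inj in H. destruct H as [_ [-> _]]. exact Vy.
      * apply (op_ext _ (fun _ => False)); [|apply op_false, HT]. intros y.
        split; [tauto|]. intros [y' [_ H]]. apply bs_inj in H. apply Hac. intuition congruence.
    + apply (op_ext _ (fun _ => False)); [|apply op_false, HT]. intros y.
      split; [tauto|]. intros [y' [_ H]]. apply bs_index in H. congruence.
  - intros [y [_ H]]. discriminate.
Qed.

Lemma brandt_sum_block_closed i a b : brandt_sum_open (fun x => forall y, x <> bs i a y b).
Proof.
  split.
  - intros j c d. destruct (classic (exists y y', bs j c y d = bs i a y' b)) as [[y [y' H]]|H].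
    + pose proof (bs_index _ _ _ _ _ _ _ _ H). subst j. apply bs_inj in H.
      destruct H as [-> [_ ->]]. apply (op_ext _ (fun _ => False)); [|apply op_false, HT].
      intros w. split; [tauto|]. intros Hw. exact (Hw w eq_refl).
    + apply (op_ext _ (fun _ => True)); [|apply op_true, HT]. intros w. split; [|tauto].
      intros _ y Hy. apply H. eauto.
  - intros _. exists (blk i a b :: nil). intros j c d Hj y y' H. apply Hj. left.
    pose proof (bs_index _ _ _ _ _ _ _ _ H). subst j. apply bs_inj in H.
    destruct H as [-> [_ ->]]. reflexivity.
Qed.

Lemma brandt_sum_hausdorff : (forall i, hausdorff (opY i)) -> hausdorff brandt_sum_open.
Proof.
  intros HH.
  assert (Hb : forall i a y b (x : brandt_sum), bs i a y b <> x ->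
    exists U V, brandt_sum_open U /\ brandt_sum_open V /\ U (bs i a y b) /\ V x /\
      forall w, ~ (U w /\ V w)).
  { intros i a y b x Hne. destruct (classic (exists y', x = bs i a y' b)) as [[y' ->]|Hx].
    - destruct (HH i y y') as [U [V [HU [HV [Uy [Vy Hd]]]]]]; [congruence|].
      exists (fun x => exists y, U y /\ x = bs i a y b), (fun x => exists y, V y /\ x = bs i a y b).
      split; [apply brandt_sum_block_open, HU|split; [apply brandt_sum_block_open, HV|]].
      split; [eauto|split; [eauto|]]. intros w [[y1 [U1 ->]] [y2 [V2 H]]].
      apply bs_inj in H. destruct H as [_ [-> _]]. exact (Hd y2 (conj U1 V2)).
    - exists (fun x => exists y, True /\ x = bs i a y b), (fun x => forall y, x <> bs i a y b).
      split; [apply (brandt_sum_block_open i a b (fun _ => True)), op_true, HT|].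
      split; [apply brandt_sum_block_closed|split; [eauto|]].
      split; [intros y' H; apply Hx; eauto|]. intros w [[y1 [_ ->]] H]. exact (H y1 eq_refl). }
  intros x x' Hne. destruct (bs_case x) as [->|[i [a [y [b ->]]]]]; [|apply Hb, Hne].
  destruct (bs_case x') as [->|[i [a [y [b ->]]]]]; [tauto|].
  destruct (Hb i a y b None) as [U [V [HU [HV [Ux [Vx Hd]]]]]]; [congruence|].
  exists V, U. repeat split; try apply HV; try apply HU; auto.
  intros w Hw. apply (Hd w). tauto.
Qed.

(** The member of the cover containing zero leaves only finitely many blocks, each compact. The
    predicate [Q] selects summands, so that the whole sum and a single Brandt semigroup are both
    instances. *)
Lemma brandt_sum_compact (Q : I -> Prop) : (forall i, compact_space (opY i)) ->
  compact_on brandt_sum_open (fun x => x = None \/ exists i a y b, Q i /\ x = bs i a y b).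
Proof.
  intros HK F HF Hcov. destruct (Hcov None) as [U0 [FU0 U00]]; [auto|].
  destruct (proj2 (HF U0 FU0) U00) as [l Hl].
  assert (Hfin : forall l' : list block_index, exists lu, (forall U, In U lu -> F U) /\
    forall i a b y, Q i -> In (blk i a b) l' -> exists U, In U lu /\ U (bs i a y b)).
  { induction l' as [|[i [a b]] l' IH].
    - exists nil. split; [intros U []|]. intros i a b y _ [].
    - destruct IH as [lu [Hlu IH]].
      assert (Hi : exists lv, (forall U, In U lv -> F U) /\
        forall y, Q i -> exists U, In U lv /\ U (bs i a y b)).
      { destruct (classic (Q i)) as [Qi|Qi].
        2: { exists nil. split; [intros U []|tauto]. }
        destruct (HK i (fun V => exists U, F U /\ V = (fun y => U (bs i a y b))))
          as [lv [Hlv Hlvc]].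
        - intros V [U [FU ->]]. apply (HF U FU).
        - intros y _. destruct (Hcov (bs i a y b)) as [U [FU Uy]].
          + right. exists i, a, y, b. auto.
          + exists (fun y => U (bs i a y b)). split; [exists U; auto|exact Uy].
        - assert (Hl2 : forall lv,
            (forall V, In V lv -> exists U, F U /\ V = (fun y => U (bs i a y b))) ->
            exists lw, (forall U, In U lw -> F U) /\
              forall V y, In V lv -> V y -> exists U, In U lw /\ U (bs i a y b)).
          { clear. induction lv as [|V lv IH]; intros H.
            - exists nil. split; [intros U []|intros V y []].
            - destruct IH as [lw [H1 H2]]; [intros; apply H; right; auto|].
              destruct (H V) as [U [FU ->]]; [left; auto|].
              exists (U :: lw). split; [intros W [<-|HW]; auto|].
              intros V y [<-|HV] Vy; [exists U; split; [left; auto|exact Vy]|].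
              destruct (H2 V y HV Vy) as [W [HW Wy]]. exists W. split; [right; auto|exact Wy]. }
          destruct (Hl2 lv Hlv) as [lw [Hlw Hlwc]]. exists lw. split; [exact Hlw|].
          intros y _. destruct (Hlvc y Logic.I) as [V [HV Vy]]. eauto. }
      destruct Hi as [lv [Hlv Hlvc]]. exists (lv ++ lu). split.
      + intros U HU. apply in_app_or in HU. destruct HU; auto.
      + intros j c d y Qj [H|H].
        * assert (i = j) by (injection H; auto). subst j.
          destruct (blk_inj i a b c d H) as [<- <-].
          destruct (Hlvc y Qj) as [U [HU Uy]]. exists U. split; [apply in_or_app; auto|exact Uy].
        * destruct (IH j c d y Qj H) as [U [HU Uy]].
          exists U. split; [apply in_or_app; auto|exact Uy]. }
  destruct (Hfin l) as [lu [Hlu Hluc]]. exists (U0 :: lu). split.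
  - intros U [<-|HU]; auto.
  - intros x [->|[i [a [y [b [Qi ->]]]]]]; [exists U0; split; [left; auto|exact U00]|].
    destruct (classic (In (blk i a b) l)) as [H|H].
    + destruct (Hluc i a b y Qi H) as [U [HU Uy]]. exists U. split; [right; auto|exact Uy].
    + exists U0. split; [left; auto|]. apply Hl, H.
Qed.

End SumTopology.

Context {ym : forall i, Y i -> Y i -> Y i} {ye : forall i, Y i} {yinv : forall i, Y i -> Y i}.

(** Specifying the product by the shape of the factors avoids deciding equality of indices and
    transporting elements along [i = j]. *)
Definition brandt_sum_mul (x y : brandt_sum) : brandt_sum :=
  epsilon (inhabits None) (fun w =>
    (exists i a g b h d, x = bs i a g b /\ y = bs i b h d /\ w = bs i a (ym i g h) d) \/
    ((forall i a g b h d, ~ (x = bs i a g b /\ y = bs i b h d)) /\ w = None)).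

Lemma brandt_sum_mul_spec x y :
    (exists i a g b h d, x = bs i a g b /\ y = bs i b h d /\
      brandt_sum_mul x y = bs i a (ym i g h) d) \/
    ((forall i a g b h d, ~ (x = bs i a g b /\ y = bs i b h d)) /\ brandt_sum_mul x y = None).
Proof.
  unfold brandt_sum_mul. apply epsilon_spec.
  destruct (classic (exists i a g b h d, x = bs i a g b /\ y = bs i b h d))
    as [[i [a [g [b [h [d [-> ->]]]]]]]|H].
  - exists (bs i a (ym i g h) d). left. exists i, a, g, b, h, d. auto.
  - exists None. right. split; [|reflexivity]. intros i a g b h d Hxy. apply H.
    exists i, a, g, b, h, d. exact Hxy.
Qed.

Lemma brandt_sum_decomp : orth_sum_decomp Lam Y ym brandt_sum_mul None bs.
Proof.
  split; [|split; [|split; [|split; [|split; [|split; [|split]]]]]].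
  - intros x. split.
    + destruct (brandt_sum_mul_spec None x) as [[i [a [g [b [h [d [H _]]]]]]]|[_ H]];
        [discriminate|exact H].
    + destruct (brandt_sum_mul_spec x None) as [[i [a [g [b [h [d [_ [H _]]]]]]]]|[_ H]];
        [discriminate|exact H].
  - discriminate.
  - apply bs_case.
  - apply bs_inj.
  - intros i j a g b a' g' b' Hij H. exact (Hij (bs_index _ _ _ _ _ _ _ _ H)).
  - intros i a g b h d. destruct (brandt_sum_mul_spec (bs i a g b) (bs i b h d))
      as [[j [a' [g' [b' [h' [d' [H1 [H2 H3]]]]]]]]|[H _]].
    + rewrite H3. pose proof (bs_index _ _ _ _ _ _ _ _ H1). subst j.
      apply bs_inj in H1, H2. destruct H1 as [<- [<- _]], H2 as [_ [<- <-]]. reflexivity.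
    + destruct (H i a g b h d). auto.
  - intros i a g b c h d Hbc. destruct (brandt_sum_mul_spec (bs i a g b) (bs i c h d))
      as [[j [a' [g' [b' [h' [d' [H1 [H2 H3]]]]]]]]|[_ H]]; [|exact H].
    pose proof (bs_index _ _ _ _ _ _ _ _ H1). subst j.
    apply bs_inj in H1, H2. destruct H1 as [_ [_ <-]], H2 as [H2 _]. congruence.
  - intros i j a g b c h d Hij. destruct (brandt_sum_mul_spec (bs i a g b) (bs j c h d))
      as [[k [a' [g' [b' [h' [d' [H1 [H2 H3]]]]]]]]|[_ H]]; [|exact H].
    apply bs_index in H1, H2. congruence.
Qed.

Hypothesis HTG : forall i, topological_group (opY i) (ym i) (ye i) (yinv i).

Local Lemma HTY i : is_topology (opY i). Proof. exact (proj1 (HTG i)). Qed.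

(** A translation by [E i a g b] sends at most one block onto a given block. Hence a finite list of
    exceptional blocks pulls back to a finite list, which is continuity at zero. *)
Local Lemma functional_image {K : Type} (r : K -> K -> Prop) (l : list K) :
  (forall k k1 k2, r k k1 -> r k k2 -> k1 = k2) ->
  exists l', forall k k', In k l -> r k k' -> In k' l'.
Proof.
  intros Hr. induction l as [|k l [l' IH]].
  - exists nil. intros k k' [].
  - destruct (classic (exists k', r k k')) as [[k1 Hk]|Hk].
    + exists (k1 :: l'). intros k2 k' [<-|H] H'; [left; eauto|right; eauto].
    + exists l'. intros k2 k' [<-|H] H'; [exfalso; eauto|eauto].
Qed.

Lemma brandt_sum_semitopological : semitopological_semigroup brandt_sum_open brandt_sum_mul.
Proof.
  assert (Hd := brandt_sum_decomp).
  split; [apply brandt_sum_is_topology, HTY|].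
  split; [apply brandt_sum_hausdorff; [apply HTY|intros i; apply (HTG i)]|].
  split; [apply (orth_sum_assoc Hd (ge := ye) (ginv := yinv)); intros i; apply (HTG i)|].
  split; intros x V HV; destruct (bs_case x) as [->|[i [a [g [b ->]]]]].
  - split.
    + intros i a b. apply (op_ext _ (fun _ => V None)); [|apply op_const, HTY].
      intros y. rewrite (os_0l Hd). tauto.
    + rewrite (os_0l Hd). intros Vz. exists nil. intros i a b _ y. rewrite (os_0l Hd). exact Vz.
  - split.
    + intros j c d. destruct (classic (i = j)) as [<-|Hij].
      * destruct (classic (b = c)) as [<-|Hbc].
        -- apply (op_ext _ (fun y => V (bs i a (ym i g y) d))).
           { intros y. rewrite (os_mul Hd). tauto. }
           exact (tg_l (HTG i) g _ (proj1 HV i a d)).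
        -- apply (op_ext _ (fun _ => V None)); [|apply op_const, HTY].
           intros y. rewrite (os_mul0 Hd) by assumption. tauto.
      * apply (op_ext _ (fun _ => V None)); [|apply op_const, HTY].
        intros y. rewrite (os_mul0_index Hd) by assumption. tauto.
    + rewrite (os_0r Hd). intros Vz. destruct (proj2 HV Vz) as [l Hl].
      destruct (functional_image
        (fun k k' => exists d, k = blk i a d /\ k' = blk i b d) l) as [l' Hl'].
      { intros k k1 k2 [d1 [-> ->]] [d2 [H ->]]. apply blk_inj in H.
        destruct H as [_ <-]. reflexivity. }
      exists l'. intros j c d Hj y.
      destruct (os_mul_case Hd i a g b (bs j c y d)) as [->|[h [d' [H ->]]]]; [exact Vz|].
      pose proof (bs_index _ _ _ _ _ _ _ _ H). subst j. apply bs_inj in H.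
      destruct H as [-> [-> ->]]. apply Hl. intros Hin. apply Hj, (Hl' _ _ Hin). eauto.
  - split.
    + intros i a b. apply (op_ext _ (fun _ => V None)); [|apply op_const, HTY].
      intros y. rewrite (os_0r Hd). tauto.
    + rewrite (os_0r Hd). intros Vz. exists nil. intros i a b _ y. rewrite (os_0r Hd). exact Vz.
  - split.
    + intros j c d. destruct (classic (j = i)) as [->|Hij].
      * destruct (classic (d = a)) as [->|Hbc].
        -- apply (op_ext _ (fun y => V (bs i c (ym i y g) b))).
           { intros y. rewrite (os_mul Hd). tauto. }
           exact (tg_r (HTG i) g _ (proj1 HV i c b)).
        -- apply (op_ext _ (fun _ => V None)); [|apply op_const, HTY].
           intros y. rewrite (os_mul0 Hd) by assumption. tauto.
      * apply (op_ext _ (fun _ => V None)); [|apply op_const, HTY].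
        intros y. rewrite (os_mul0_index Hd) by assumption. tauto.
    + rewrite (os_0l Hd). intros Vz. destruct (proj2 HV Vz) as [l Hl].
      destruct (functional_image
        (fun k k' => exists c, k = blk i c b /\ k' = blk i c a) l) as [l' Hl'].
      { intros k k1 k2 [d1 [-> ->]] [d2 [H ->]]. apply blk_inj in H.
        destruct H as [<- _]. reflexivity. }
      exists l'. intros j c d Hj y.
      destruct (os_mul_case Hd j c y d (bs i a g b)) as [->|[h [d' [H ->]]]]; [exact Vz|].
      pose proof (bs_index _ _ _ _ _ _ _ _ H). subst j. apply bs_inj in H.
      destruct H as [-> [-> ->]]. apply Hl. intros Hin. apply Hj, (Hl' _ _ Hin). eauto.
Qed.

Definition brandt_sum_inv (x : brandt_sum) : brandt_sum :=
  match x with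
  | None => None
  | Some s => let k := projT1 s in bs (projT1 k) (snd (projT2 k)) (yinv _ (projT2 s)) (fst (projT2 k))
  end.

Lemma brandt_sum_inv_spec x :
  brandt_sum_mul (brandt_sum_mul x (brandt_sum_inv x)) x = x /\
  brandt_sum_mul (brandt_sum_mul (brandt_sum_inv x) x) (brandt_sum_inv x) = brandt_sum_inv x.
Proof.
  assert (Hd := brandt_sum_decomp).
  destruct (bs_case x) as [->|[i [a [g [b ->]]]]]; simpl.
  - rewrite !(os_0l Hd). auto.
  - assert (Hg : is_group (ym i) (ye i) (yinv i)) by apply (HTG i).
    rewrite !(os_mul Hd). split; f_equal; grp Hg; reflexivity.
Qed.

Lemma brandt_sum_inv_continuous : continuous brandt_sum_open brandt_sum_open brandt_sum_inv.
Proof.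
  intros V [HV HV0]. split.
  - intros i a b. simpl. destruct (HTG i) as [_ [_ [_ [_ Hi]]]]. exact (Hi _ (HV i b a)).
  - simpl. intros Vz. destruct (HV0 Vz) as [l Hl].
    exists (map (fun k : block_index => blk (projT1 k) (snd (projT2 k)) (fst (projT2 k))) l).
    intros i a b Hi y. simpl. apply Hl. intros Hin. apply Hi.
    apply (in_map (fun k : block_index => blk (projT1 k) (snd (projT2 k)) (fst (projT2 k)))) in Hin.
    exact Hin.
Qed.

Lemma brandt_sum_diagonal_embedding i a :
  embedding (opY i) brandt_sum_open (fun y => bs i a y a).
Proof.
  split; [|split].
  - intros y y' H. apply bs_inj in H. apply H.
  - intros V [HV _]. apply HV.
  - intros V HV. exists (fun x => exists y, V y /\ x = bs i a y a).
    split; [apply brandt_sum_block_open; [apply HTY|exact HV]|].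
    intros y. split; [eauto|]. intros [y' [Vy H]]. apply bs_inj in H.
    destruct H as [_ [-> _]]. exact Vy.
Qed.

End BrandtSum.

(** * The structure of S *)

Lemma pullback_is_topology {Y X : Type} (op : (X -> Prop) -> Prop) (h : Y -> X) :
  is_topology op -> is_topology (pullback op h).
Proof.
  intros HT. split; [|split].
  - exists (fun _ => True). split; [apply op_true, HT|tauto].
  - intros U V [U' [HU HUU]] [V' [HV HVV]]. exists (fun x => U' x /\ V' x).
    split; [apply op_and; assumption|]. intros y. rewrite HUU, HVV. tauto.
  - intros F HF. exists (fun x => exists W, (op W /\ exists V, F V /\ forall y, V y <-> W (h y)) /\ W x).
    split.
    + apply HT. tauto.
    + intros y. split.
      * intros [V [FV Vy]]. destruct (HF V FV) as [W [HW HWV]]. exists W.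
        split; [eauto|]. apply HWV, Vy.
      * intros [W [[_ [V [FV HV]]] Wy]]. exists V. split; [exact FV|]. apply HV, Wy.
Qed.

Lemma pullback_continuous {Y X : Type} (op : (X -> Prop) -> Prop) (h : Y -> X) :
  continuous (pullback op h) op h.
Proof. intros U HU. exists U. split; [exact HU|tauto]. Qed.

Lemma pullback_hausdorff {Y X : Type} (op : (X -> Prop) -> Prop) (h : Y -> X) :
  hausdorff op -> (forall y y', h y = h y' -> y = y') -> hausdorff (pullback op h).
Proof.
  intros HH Hinj y y' Hne. destruct (HH (h y) (h y')) as [U [V [HU [HV [Uy [Vy Hd]]]]]]; [auto|].
  exists (fun y => U (h y)), (fun y => V (h y)).
  split; [exact (pullback_continuous op h U HU)|split; [exact (pullback_continuous op h V HV)|]].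
  split; [exact Uy|split; [exact Vy|]]. intros w. apply Hd.
Qed.

Lemma pullback_shrinking {Y X : Type} (op : (X -> Prop) -> Prop) (h : Y -> X) :
  shrinking op -> shrinking (pullback op h).
Proof.
  intros Hs U y [U' [HU HUU]] Uy. destruct (Hs U' (h y) HU) as [V [HV [Vy HVU]]].
  { apply HUU, Uy. }
  exists (fun y => V (h y)). split; [exact (pullback_continuous op h V HV)|split; [exact Vy|]].
  intros w Hw. apply HUU, HVU.
  exact (cl_continuous _ _ h _ V w (pullback_continuous op h) (fun _ H => H) Hw).
Qed.

Lemma infinitely_often_subsequence (P : nat -> Prop) :
  (forall N, exists n, (N <= n)%nat /\ P n) ->
  exists phi : nat -> nat, (forall k, P (phi k)) /\
    forall i j, (i < j)%nat -> (phi i < phi j)%nat.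
Proof.
  intros H. destruct (H 0%nat) as [n0 [_ Hn0]].
  destruct (dependent_choice P (fun a b => (a < b)%nat) n0 Hn0) as [phi [_ Hphi]].
  - intros a _. destruct (H (S a)) as [b [Hb Pb]]. exists b. split; [exact Pb|lia].
  - exists phi. split; [apply Hphi|].
    assert (Hd : forall i d, (phi i < phi (d + S i))%nat).
    { intros i. induction d as [|d IH]; simpl; [apply Hphi|].
      pose proof (proj2 (Hphi (d + S i)%nat)). lia. }
    intros i j Hij. replace j with (j - S i + S i)%nat by lia. apply Hd.
Qed.

Section PrimitiveInverseSemigroup.
Context {S : Type} {opS : (S -> Prop) -> Prop} {m : S -> S -> S} {z : S}
  {I : Type} {Lam : I -> Type} {G : I -> Type}
  {gm : forall i, G i -> G i -> G i} {ge : forall i, G i} {ginv : forall i, G i -> G i}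
  {E : forall i, Lam i -> G i -> Lam i -> S} {alpha : forall i, Lam i}.
Hypotheses (HS : semitopological_semigroup opS m) (Hreg : regular opS)
  (Hcc : countably_compact opS) (HG : forall i, is_group (gm i) (ge i) (ginv i))
  (Hsum : orth_sum_decomp Lam G gm m z E).

Definition opG (i : I) : (G i -> Prop) -> Prop :=
  pullback opS (fun g => E i (alpha i) g (alpha i)).

Local Lemma sg_topology : is_topology opS. Proof. apply HS. Qed.
Local Lemma sg_hausdorff : hausdorff opS. Proof. apply HS. Qed.
Local Lemma sg_shrinking : shrinking opS. Proof. exact (regular_shrinking opS Hreg). Qed.
Local Lemma sg_mul_l a : continuous opS opS (fun x => m a x). Proof. apply HS. Qed.
Local Lemma sg_mul_r a : continuous opS opS (fun x => m x a). Proof. apply HS. Qed.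
Local Lemma op_nonzero : opS (fun x => x <> z).
Proof. exact (hausdorff_op_neq opS sg_topology sg_hausdorff z). Qed.

(* Maps the block [(a, b)] homeomorphically onto [(c, d)] and everything else to zero. *)
Definition shift i (a b c d : Lam i) (x : S) : S :=
  m (m (E i c (ge i) a) x) (E i b (ge i) d).

Lemma shift_block i a b c d g : shift i a b c d (E i a g b) = E i c g d.
Proof.
  unfold shift. rewrite !(os_mul Hsum). f_equal. grp (HG i). reflexivity.
Qed.

Lemma shift_nonzero i a b c d x : shift i a b c d x <> z -> exists g, x = E i a g b.
Proof.
  unfold shift. intros H.
  destruct (os_mul_case Hsum i c (ge i) a x) as [H0|[h [q [-> H0]]]]; rewrite H0 in H.
  - rewrite (os_0l Hsum) in H. tauto.
  - exists h. destruct (os_mul_case Hsum i c (gm i (ge i) h) q (E i b (ge i) d))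
      as [H1|[h' [d' [H1 _]]]]; [congruence|].
    apply (os_inj Hsum) in H1. destruct H1 as [-> _]. reflexivity.
Qed.

Lemma shift_zero i a b c d : shift i a b c d z = z.
Proof. unfold shift. rewrite (os_0r Hsum), (os_0l Hsum). reflexivity. Qed.

Lemma shift_continuous i a b c d : continuous opS opS (shift i a b c d).
Proof.
  intros V HV. exact (sg_mul_l (E i c (ge i) a) _ (sg_mul_r (E i b (ge i) d) V HV)).
Qed.

Lemma section_open U i a b : opS U -> opG i (fun g => U (E i a g b)).
Proof.
  intros HU. exists (fun x => U (shift i (alpha i) (alpha i) a b x)).
  split; [apply shift_continuous, HU|]. intros g. rewrite shift_block. tauto.
Qed.

(** The block [(a, b)] is the set where a continuous [shift] is nonzero, and the complement of zero
    is open. *)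
Lemma block_subset_open i a b V : opG i V -> opS (fun x => exists g, V g /\ x = E i a g b).
Proof.
  intros [U [HU HUV]].
  apply (op_ext opS (fun x => (shift i a b a b x <> z) /\ U (shift i a b (alpha i) (alpha i) x))).
  - intros x. split.
    + intros [H1 H2]. destruct (shift_nonzero _ _ _ _ _ _ H1) as [g ->].
      rewrite shift_block in H2. exists g. split; [apply HUV, H2|reflexivity].
    + intros [g [Vg ->]]. rewrite !shift_block. split; [apply (os_neq0 Hsum)|apply HUV, Vg].
  - apply (op_and opS sg_topology); [exact (shift_continuous i a b a b _ op_nonzero)|].
    apply shift_continuous, HU.
Qed.

Local Lemma opG_topology i : is_topology (opG i).
Proof. apply pullback_is_topology, sg_topology. Qed.

Lemma block_open i a b : opS (fun x => exists g, x = E i a g b).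
Proof.
  apply (op_ext opS (fun x => exists g, True /\ x = E i a g b)).
  - intros x. split; intros [g H]; exists g; tauto.
  - apply (block_subset_open i a b (fun _ => True)), op_true, opG_topology.
Qed.

(** A nonzero cluster point lies in an open block that the sequence must enter, so this is the block
    of the sequence itself. *)
Lemma cluster_block i (u : nat -> G i) (x : S) :
  cluster opS (fun n => E i (alpha i) (u n) (alpha i)) x -> x <> z ->
  exists g, x = E i (alpha i) g (alpha i) /\ cluster (opG i) u g.
Proof.
  intros Hx Hxz. destruct (os_case Hsum x) as [->|[j [a [g [b ->]]]]]; [tauto|].
  destruct (Hx _ (block_open j a b) (ex_intro _ g eq_refl) 0%nat) as [n [_ [h H]]].
  pose proof (os_index Hsum _ _ _ _ _ _ _ _ H). subst j.
  apply (os_inj Hsum) in H. destruct H as [<- [_ <-]].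
  exists g. split; [reflexivity|]. intros V HV Vg N.
  destruct (Hx _ (block_subset_open i (alpha i) (alpha i) V HV)
    (ex_intro _ g (conj Vg eq_refl)) N) as [k [Hk [h' [Vh H]]]].
  apply (os_inj Hsum) in H. destruct H as [_ [<- _]]. eauto.
Qed.

Local Lemma cluster_exists (u : nat -> S) : exists x, cluster opS u x.
Proof. exact (countably_compact_cluster opS sg_topology Hcc u). Qed.

(** Local countable compactness comes from a neighbourhood [K] of the unit whose closure misses
    zero: a sequence in it clusters in [S], away from zero, hence inside the block. *)
Lemma block_topological_group i : topological_group (opG i) (gm i) (ge i) (ginv i).
Proof.
  destruct (sg_shrinking _ _ op_nonzero (os_neq0 Hsum i (alpha i) (ge i) (alpha i)))
    as [K [HK [Ke HKz]]].
  assert (Hl : forall a, continuous (opG i) (opG i) (fun x => gm i a x)).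
  { intros a V [U [HU HUV]]. exists (fun x => U (m (E i (alpha i) a (alpha i)) x)).
    split; [exact (sg_mul_l _ U HU)|]. intros g. rewrite (os_mul Hsum). apply HUV. }
  assert (Hr : forall a, continuous (opG i) (opG i) (fun x => gm i x a)).
  { intros a V [U [HU HUV]]. exists (fun x => U (m x (E i (alpha i) a (alpha i)))).
    split; [exact (sg_mul_r _ U HU)|]. intros g. rewrite (os_mul Hsum). apply HUV. }
  apply (locally_countably_compact_topological_group (opG_topology i) (HG i) Hl Hr
    (pullback_shrinking opS _ sg_shrinking) (K := fun g => K (E i (alpha i) g (alpha i)))).
  - exact (pullback_continuous _ _ K HK).
  - exact Ke.
  - intros u Hu. destruct (cluster_exists (fun n => E i (alpha i) (u n) (alpha i))) as [x Hx].
    destruct (cluster_block i u x Hx) as [g [_ Hg]]; [|eauto].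
    apply HKz. apply (cluster_cl opS _ _ _ 0%nat Hx). auto.
  - apply pullback_hausdorff; [exact sg_hausdorff|]. intros g h H. apply (os_inj Hsum) in H. apply H.
Qed.

(** * Isolating zero from a diagonal block *)

Section ZeroIsolated.
Context (i : I).
Local Notation En g := (E i (alpha i) g (alpha i)).

Local Lemma separate_unit_zero : exists U W, opS U /\ opS W /\ U (En (ge i)) /\ W z /\
  forall x, ~ (U x /\ W x).
Proof.
  exact (sg_hausdorff _ _ (os_neq0 Hsum i (alpha i) (ge i) (alpha i))).
Qed.

Local Lemma translate_off_zero (W : S -> Prop) g : opS W -> W z ->
  opS (fun x => W (m (En g) x)) /\ W (m (En g) z).
Proof.
  intros HW Wz. split; [exact (sg_mul_l _ W HW)|]. rewrite (os_0r Hsum). exact Wz.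
Qed.

(** If [U] and [W] separate the unit from zero and [G = F U], the intersection over [f] in [F] of
    the preimages of [W] under translation by [f^-1] misses every [f U]. *)
Lemma zero_isolated_of_precompact :
  left_precompact (opG i) (gm i) (ge i) -> exists W, opS W /\ W z /\ forall g, ~ W (En g).
Proof.
  intros Hp. destruct separate_unit_zero as [U [W [HU [HW [Ue [Wz Hd]]]]]].
  destruct (Hp (fun g => U (En g)) (pullback_continuous _ _ U HU) Ue) as [F HF].
  exists (fun x => forall f, In f F -> W (m (En (ginv i f)) x)).
  split; [|split].
  - apply (op_list opS sg_topology (fun f x => W (m (En (ginv i f)) x))).
    intros f _. apply translate_off_zero; assumption.
  - intros f _. apply translate_off_zero; assumption.
  - intros g Hg. destruct (HF g) as [f [u [Hf [Uu ->]]]].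
    specialize (Hg f Hf). rewrite (os_mul Hsum), (g_Kl (HG i)) in Hg.
    exact (Hd _ (conj Uu Hg)).
Qed.

(* Otherwise the traces of a shrinking sequence of neighbourhoods of zero would be an
   infinite locally finite family of open sets. *)
Lemma zero_isolated_of_omega_precompact :
  left_omega_precompact (opG i) (gm i) (ge i) -> pseudocompact (opG i) ->
  exists W, opS W /\ W z /\ forall g, ~ W (En g).
Proof.
  intros Hp Hps. apply NNPP. intros Hno.
  assert (Hacc : forall W, opS W -> W z -> exists g, W (En g)).
  { intros W HW Wz. apply NNPP. intros H. apply Hno. exists W. repeat split; auto.
    intros g Wg. apply H. eauto. }
  destruct separate_unit_zero as [U [W [HU [HW [Ue [Wz Hd]]]]]].
  destruct (Hp (fun g => U (En g)) (pullback_continuous _ _ U HU) Ue) as [F HF].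
  pose (Wn := fun n x => W (m (En (ginv i (F n))) x)).
  destruct (dependent_choice
    (fun s : nat * (S -> Prop) => opS (snd s) /\ snd s z)
    (fun s t => fst t = Datatypes.S (fst s) /\
       forall x, cl opS (snd t) x -> snd s x /\ Wn (fst s) x) (0%nat, fun _ => True))
    as [s [Hs0 Hsn]].
  { simpl. split; [apply op_true, sg_topology|exact Logic.I]. }
  { intros [n V] [HV Vz]. simpl in *.
    destruct (translate_off_zero W (ginv i (F n)) HW Wz) as [HW1 HW2].
    destruct (sg_shrinking (fun x => V x /\ Wn n x) z) as [V' [HV' [V'z HVV]]].
    - apply (op_and opS sg_topology); [exact HV|exact HW1].
    - split; [exact Vz|exact HW2].
    - exists (Datatypes.S n, V'). simpl. auto. }
  assert (Hfst : forall n, fst (s n) = n).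
  { induction n as [|n IH]; [rewrite Hs0; reflexivity|].
    rewrite (proj1 (proj2 (Hsn n))), IH. reflexivity. }
  pose (V := fun n => snd (s n)).
  assert (HV : forall n, opS (V n) /\ V n z) by (intros n; apply Hsn).
  assert (HVc : forall n x, cl opS (V (Datatypes.S n)) x -> V n x /\ Wn n x).
  { intros n. pose proof (proj2 (proj2 (Hsn n))) as H. rewrite Hfst in H. exact H. }
  clearbody V. clear s Hs0 Hsn Hfst.
  assert (Hmono : forall n k x, V (k + n)%nat x -> V n x).
  { intros n k. induction k as [|k IH]; simpl; auto. intros x Hx. apply IH.
    apply (HVc (k + n)%nat), (cl_incl opS), Hx. }
  pose (P := fun n (g : G i) => V n (En g)).
  (* An element [g = F n * u] with [u] in [U] is carried into [U] by the inverse of [F n], whereas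
     that translation sends [cl (V (n+1))] into [W]. So the closures have no common point in the
     group, which is local finiteness. *)
  assert (Hlf : forall g, exists n, ~ cl opS (V (Datatypes.S n)) (En g)).
  { intros g. destruct (HF g) as [n [u [Uu ->]]]. exists n. intros Hc.
    apply HVc in Hc. destruct Hc as [_ Hc]. unfold Wn in Hc.
    rewrite (os_mul Hsum), (g_Kl (HG i)) in Hc. exact (Hd _ (conj Uu Hc)). }
  destruct (Hps (fun Q => exists n, Q = P n)) as [l Hl].
  - intros Q [n ->]. split; [exact (pullback_continuous _ _ _ (proj1 (HV n)))|].
    apply Hacc; apply HV.
  - intros g. destruct (Hlf g) as [n Hn].
    exists (fun h => ~ cl opS (V (Datatypes.S n)) (En h)).
    split; [exact (pullback_continuous _ _ _ (op_not_cl opS sg_topology _))|split; [exact Hn|]].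
    exists (map P (seq 0 (Datatypes.S n))). intros Q [k ->] [h [Ph Hh]].
    apply in_map. apply in_seq. split; [lia|]. apply Nat.nle_gt. intros Hk. apply Hh.
    apply (cl_incl opS). apply (Hmono _ (k - Datatypes.S n)%nat).
    replace (k - Datatypes.S n + Datatypes.S n)%nat with k by lia. exact Ph.
  - assert (Hout : forall l : list (G i -> Prop), exists N, forall Q, In Q l ->
      forall k, (N <= k)%nat -> Q <> P k).
    { induction l0 as [|Q l0 [N IH]].
      - exists 0%nat. intros Q [].
      - destruct (classic (exists g, Q g)) as [[g Qg]|HQ].
        + destruct (Hlf g) as [n Hn]. exists (N + Datatypes.S n)%nat.
          intros Q' [<-|HQ'] k Hk; [|apply IH; [exact HQ'|lia]].
          intros ->. apply Hn, (cl_incl opS), (Hmono _ (k - Datatypes.S n)%nat).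
          replace (k - Datatypes.S n + Datatypes.S n)%nat with k by lia. exact Qg.
        + exists N. intros Q' [<-|HQ'] k Hk; [|apply IH; assumption].
          intros ->. apply HQ. apply Hacc; apply HV. }
    destruct (Hout l) as [N HN]. exact (HN (P N) (Hl _ (ex_intro _ N eq_refl)) N (le_n N) eq_refl).
Qed.

(** A subsequence staying outside [W] would cluster in [S], and zero is the only cluster point left
    to it. *)
Lemma no_cluster_tends_to_zero (v : nat -> G i) (W : S -> Prop) :
  (forall phi : nat -> nat, (forall j k, (j < k)%nat -> (phi j < phi k)%nat) ->
     forall h, ~ cluster (opG i) (fun n => v (phi n)) h) ->
  opS W -> W z -> exists N, forall n, (N <= n)%nat -> W (En (v n)).
Proof.
  intros Hv HW Wz. apply NNPP. intros Hno.
  destruct (infinitely_often_subsequence (fun n => ~ W (En (v n)))) as [phi [Hphi Hinc]].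
  { intros N. apply NNPP. intros H. apply Hno. exists N. intros n Hn.
    apply NNPP. intros H'. apply H. eauto. }
  destruct (cluster_exists (fun n => En (v (phi n)))) as [x Hx].
  destruct (classic (x = z)) as [->|Hxz].
  - destruct (Hx W HW Wz 0%nat) as [n [_ Hn]]. exact (Hphi n Hn).
  - destruct (cluster_block i _ x Hx Hxz) as [g [_ Hg]]. exact (Hv phi Hinc g Hg).
Qed.

(* If the group is not precompact, a separated sequence and its inverses both tend to
   zero, and so does the constant product of the two. *)
Lemma left_precompact_of_jointly_continuous :
  jointly_continuous_on opS m (fun x => x = z \/ exists g, x = En g) ->
  left_precompact (opG i) (gm i) (ge i).
Proof.
  intros Hj V HV Ve. assert (HTG := block_topological_group i).
  destruct (precompact_or_separated (m := gm i) (inv := ginv i) V) as [[F HF]|[u Hu]].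
  - exists F. intros g. destruct (HF g) as [f [Hf Vf]]. exists f, (gm i (ginv i f) g).
    split; [exact Hf|split; [exact Vf|]]. symmetry. apply (g_Kr (HG i)).
  - exfalso.
    destruct (Hj z z (or_introl eq_refl) (or_introl eq_refl) (fun x => x <> En (ge i)))
      as [U1 [U2 [HU1 [HU2 [U1z [U2z HU]]]]]].
    { exact (hausdorff_op_neq opS sg_topology sg_hausdorff _). }
    { rewrite (os_0l Hsum). intros H. exact (os_neq0 Hsum _ _ _ _ (eq_sym H)). }
    assert (Hnc : forall phi : nat -> nat, (forall j k, (j < k)%nat -> (phi j < phi k)%nat) ->
      forall h, ~ cluster (opG i) (fun n => u (phi n)) h).
    { intros phi Hphi. apply (separated_no_cluster HTG V _ HV Ve). auto. }
    destruct (no_cluster_tends_to_zero u U1 Hnc HU1 U1z) as [N1 HN1].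
    destruct (no_cluster_tends_to_zero (fun n => ginv i (u n)) U2) as [N2 HN2];
      [|exact HU2|exact U2z|].
    { intros phi Hphi h Hh. apply (Hnc phi Hphi (ginv i h)).
      pose proof (cluster_continuous _ _ _ _ _ (tg_inv HTG) Hh) as H.
      intros W HW Wh N. destruct (H W HW Wh N) as [n [Hn Wn]]. exists n.
      rewrite (g_VV (HG i)) in Wn. auto. }
    apply (HU (En (u (N1 + N2)%nat)) (En (ginv i (u (N1 + N2)%nat)))).
    + right; eauto.
    + right; eauto.
    + apply HN1. lia.
    + apply HN2. lia.
    + rewrite (os_mul Hsum), (g_Vr (HG i)). reflexivity.
Qed.

End ZeroIsolated.

Hypothesis Hcond : forall i,
     left_precompact (opG i) (gm i) (ge i) \/
     (left_omega_precompact (opG i) (gm i) (ge i) /\ pseudocompact (opG i)) \/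
     jointly_continuous_on opS m
       (fun x => x = z \/ exists g, x = E i (alpha i) g (alpha i)).

Lemma zero_isolated_from_block i a b :
  exists W, opS W /\ W z /\ forall g, ~ W (E i a g b).
Proof.
  assert (H : exists W, opS W /\ W z /\ forall g, ~ W (E i (alpha i) g (alpha i))).
  { destruct (Hcond i) as [H|[[H1 H2]|H]].
    - exact (zero_isolated_of_precompact i H).
    - exact (zero_isolated_of_omega_precompact i H1 H2).
    - exact (zero_isolated_of_precompact i (left_precompact_of_jointly_continuous i H)). }
  destruct H as [W [HW [Wz H]]].
  exists (fun x => W (shift i a b (alpha i) (alpha i) x)).
  split; [exact (shift_continuous _ _ _ _ _ _ HW)|].
  split; [rewrite shift_zero; exact Wz|]. intros g. rewrite shift_block. apply H.
Qed.

Lemma block_countably_compact i (u : nat -> G i) : exists g, cluster (opG i) u g.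
Proof.
  destruct (cluster_exists (fun n => E i (alpha i) (u n) (alpha i))) as [x Hx].
  destruct (cluster_block i u x Hx) as [g [_ Hg]]; [|eauto].
  intros ->. destruct (zero_isolated_from_block i (alpha i) (alpha i)) as [W [HW [Wz H]]].
  destruct (Hx W HW Wz 0%nat) as [n [_ Hn]]. exact (H _ Hn).
Qed.

Lemma block_complement_open i a b : opS (fun x => forall g, x <> E i a g b).
Proof.
  apply (op_local opS sg_topology). intros x Hx.
  destruct (os_case Hsum x) as [->|[j [c [h [d ->]]]]].
  - destruct (zero_isolated_from_block i a b) as [W [HW [Wz H]]].
    exists W. split; [exact HW|split; [exact Wz|]]. intros y Wy g ->. exact (H g Wy).
  - exists (fun x => exists g, x = E j c g d).
    split; [apply block_open|split; [eauto|]]. intros y [h' ->] g H.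
    pose proof (os_index Hsum _ _ _ _ _ _ _ _ H). subst j.
    apply (os_inj Hsum) in H. destruct H as [-> [_ ->]]. exact (Hx h eq_refl).
Qed.

(** Otherwise points outside [U] can be picked from pairwise distinct blocks. Their cluster point is
    not zero, and it lies in no block, since blocks are open and each contains at most one of the
    points. *)
Lemma zero_nbhd_cofinite U : opS U -> U z ->
  exists l, forall i a b, ~ In (blk i a b) l -> forall g, U (E i a g b).
Proof.
  intros HU Uz. apply NNPP. intros Hno.
  destruct (sequence_of_lists (fun (l : list (block_index * S)) p =>
    ~ In (fst p) (map fst l) /\ ~ U (snd p) /\
    exists i a g b, fst p = blk (Lam := Lam) i a b /\ snd p = E i a g b)) as [u Hu].
  - intros l. apply NNPP. intros H. apply Hno. exists (map fst l). intros i a b Hi g.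
    apply NNPP. intros HnU. apply H. exists (blk i a b, E i a g b). simpl.
    split; [exact Hi|split; [exact HnU|]]. exists i, a, g, b. auto.
  - destruct (cluster_exists (fun n => snd (u n))) as [x Hx].
    destruct (os_case Hsum x) as [->|[i [a [g [b ->]]]]].
    + destruct (Hx U HU Uz 0%nat) as [n [_ Hn]]. destruct (Hu n) as [l [[_ [H _]] _]]. auto.
    + assert (Hfst : forall n, (exists h, snd (u n) = E i a h b) -> fst (u n) = blk i a b).
      { intros n [h H]. destruct (Hu n) as [l [[_ [_ [j [c [h' [d [-> H']]]]]]] _]].
        rewrite H in H'. pose proof (os_index Hsum _ _ _ _ _ _ _ _ H'). subst j.
        apply (os_inj Hsum) in H'. destruct H' as [-> [_ ->]]. reflexivity. }
      destruct (Hx _ (block_open i a b) (ex_intro _ g eq_refl) 0%nat) as [n [_ Hn]].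
      destruct (Hx _ (block_open i a b) (ex_intro _ g eq_refl) (Datatypes.S n)) as [k [Hk Hk']].
      destruct (Hu k) as [l [[H _] Hin]]. apply H.
      rewrite (Hfst k Hk'), <- (Hfst n Hn). apply in_map, Hin, Hk.
Qed.

(** This is the description used in [brandt_sum_open], so it allows [S] to be compared with a sum
    block by block. For the converse at zero, removing finitely many blocks leaves an open set
    because zero is isolated from each block. *)
Lemma open_iff U : opS U <->
  ((forall i a b, opG i (fun g => U (E i a g b))) /\
   (U z -> exists l, forall i a b, ~ In (blk i a b) l -> forall g, U (E i a g b))).
Proof.
  split.
  - intros HU. split; [intros; apply section_open, HU|apply zero_nbhd_cofinite, HU].
  - intros [H1 H2]. apply (op_local opS sg_topology). intros x Ux.
    destruct (os_case Hsum x) as [->|[i [a [g [b ->]]]]].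
    + destruct (H2 Ux) as [l Hl].
      exists (fun x => forall k, In k l ->
        forall g, x <> E (projT1 k) (fst (projT2 k)) g (snd (projT2 k))).
      split; [|split].
      * apply (op_list opS sg_topology (fun k x =>
          forall g, x <> E (projT1 k) (fst (projT2 k)) g (snd (projT2 k)))).
        intros k _. apply block_complement_open.
      * intros k _ g H. exact (os_neq0 Hsum _ _ _ _ (eq_sym H)).
      * intros y Hy. destruct (os_case Hsum y) as [->|[i [a [g [b ->]]]]]; [exact Ux|].
        apply Hl. intros Hin. exact (Hy _ Hin g eq_refl).
    + exists (fun x => exists h, U (E i a h b) /\ x = E i a h b).
      split; [apply (block_subset_open i a b (fun h => U (E i a h b))), H1|].
      split; [eauto|]. intros y [h [Uh ->]]. exact Uh.
Qed.

(** At zero the function is the indicator of a finite union of clopen blocks. At a point of a block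
    it is a separating function of the group, extended by 1 to the rest of [S]. *)
Lemma semigroup_tychonoff : tychonoff opS.
Proof.
  split; [exact sg_hausdorff|]. intros C x HC Cx.
  destruct (os_case Hsum x) as [->|[i [a [h [b ->]]]]].
  - destruct (zero_nbhd_cofinite _ HC Cx) as [l Hl].
    pose (B := fun x => exists i a g b, In (blk i a b) l /\ x = E i a g b).
    exists (fun x => if excluded_middle_informative (B x) then 1 else 0).
    assert (HB : forall i a g b, B (E i a g b) <-> In (blk i a b) l).
    { intros i a g b. split; [|intros H; exists i, a, g, b; auto].
      intros [j [c [h [d [Hin H]]]]]. pose proof (os_index Hsum _ _ _ _ _ _ _ _ H). subst j.
      apply (os_inj Hsum) in H. destruct H as [-> [_ ->]]. exact Hin. }
    assert (HBz : ~ B z).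
    { intros [i [a [g [b [_ H]]]]]. exact (os_neq0 Hsum _ _ _ _ (eq_sym H)). }
    split; [|split; [|split]].
    + intros V HV. apply open_iff. split.
      * intros i a b.
        apply (op_ext _ (fun _ => V (if excluded_middle_informative (In (blk i a b) l) then 1 else 0)));
          [|apply op_const, opG_topology].
        intros g. pose proof (HB i a g b).
        destruct (excluded_middle_informative (B _)), (excluded_middle_informative (In _ _));
          tauto.
      * destruct (excluded_middle_informative (B z)) as [H|_]; [tauto|]. intros V0.
        exists l. intros i a b Hi g. pose proof (HB i a g b).
        destruct excluded_middle_informative; tauto.
    + destruct excluded_middle_informative; tauto.
    + intros y Cy. destruct excluded_middle_informative as [H|H]; [reflexivity|]. exfalso.
      destruct (os_case Hsum y) as [->|[i [a [g [b ->]]]]]; [exact (Cx Cy)|].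
      rewrite HB in H. exact (Hl i a b H g Cy).
    + intros y. destruct excluded_middle_informative; lra.
  - destruct (topological_group_completely_regular (block_topological_group i)
      (block_countably_compact i) (fun g => ~ C (E i a g b)) h
      (section_open _ i a b HC) Cx) as [f [Hf [Hfh [Hf1 Hfb]]]].
    assert (Hch : forall x, exists r, (exists g, x = E i a g b /\ r = f g) \/
      ((forall g, x <> E i a g b) /\ r = 1)).
    { intros x. destruct (classic (exists g, x = E i a g b)) as [[g Hg]|H]; [eauto|].
      exists 1. right. split; [|reflexivity]. intros g Hg. apply H. eauto. }
    destruct (choice _ Hch) as [F HF].
    assert (HFb : forall g, F (E i a g b) = f g).
    { intros g. destruct (HF (E i a g b)) as [[g' [H ->]]|[H _]]; [|destruct (H g eq_refl)].
      apply (os_inj Hsum) in H. destruct H as [_ [-> _]]. reflexivity. }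
    assert (HFo : forall x, (forall g, x <> E i a g b) -> F x = 1).
    { intros x Hx. destruct (HF x) as [[g [H _]]|[_ H]]; [destruct (Hx g H)|exact H]. }
    exists F. split; [|split; [|split]].
    + intros V HV. apply open_iff. split.
      * intros j c d. destruct (classic (blk j c d = blk i a b)) as [H|H].
        -- assert (i = j) by (apply (f_equal (@projT1 _ _)) in H; simpl in H; auto). subst j.
           apply blk_inj in H. destruct H as [-> ->].
           apply (op_ext _ (fun g => V (f g))); [|exact (Hf V HV)].
           intros g. rewrite HFb. tauto.
        -- apply (op_ext _ (fun _ => V 1)); [|apply op_const, opG_topology]. intros g.
           rewrite HFo; [tauto|]. intros g' H'.
           pose proof (os_index Hsum _ _ _ _ _ _ _ _ H'). subst j.
           apply (os_inj Hsum) in H'. destruct H' as [-> [_ ->]]. auto.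
      * rewrite (HFo z).
        2: { intros g H. exact (os_neq0 Hsum _ _ _ _ (eq_sym H)). }
        intros V1. exists (blk i a b :: nil). intros j c d Hj g. rewrite HFo; [exact V1|].
        intros g' H'. pose proof (os_index Hsum _ _ _ _ _ _ _ _ H'). subst j.
        apply (os_inj Hsum) in H'. destruct H' as [-> [_ ->]]. apply Hj. left; reflexivity.
    + rewrite HFb. exact Hfh.
    + intros y Cy. destruct (classic (exists g, y = E i a g b)) as [[g ->]|H].
      * rewrite HFb. apply Hf1. tauto.
      * apply HFo. intros g Hg. apply H. eauto.
    + intros y. destruct (HF y) as [[g [_ ->]]|[_ ->]]; [apply Hfb|lra].
Qed.

End PrimitiveInverseSemigroup.

(** * The Stone-Cech compactification of S *)

Lemma brandt_sum_stone_cech {S : Type} {opS : (S -> Prop) -> Prop} {m : S -> S -> S} {z : S}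
  {I : Type} {Lam G : I -> Type} {gm : forall i, G i -> G i -> G i}
  {E : forall i, Lam i -> G i -> Lam i -> S}
  (Hsum : orth_sum_decomp Lam G gm m z E)
  {opG : forall i, (G i -> Prop) -> Prop}
  (Hopen : forall U, opS U <->
    ((forall i a b, opG i (fun g => U (E i a g b))) /\
     (U z -> exists l, forall i a b, ~ In (blk i a b) l -> forall g, U (E i a g b))))
  {Y : I -> Type} {opY : forall i, (Y i -> Prop) -> Prop} {k : forall i, G i -> Y i}
  (Hk : forall i, stone_cech (opG i) (opY i) (k i))
  (j : S -> brandt_sum (Lam := Lam) (Y := Y)) (jz : j z = None)
  (jE : forall i a g b, j (E i a g b) = bs i a (k i g) b) :
  stone_cech opS (brandt_sum_open (opY := opY)) j.
Proof.
  assert (HT : forall i, is_topology (opY i)) by (intros i; apply (Hk i)).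
  split; [apply brandt_sum_is_topology, HT|].
  split.
  { intros F HF Hcov.
    destruct (brandt_sum_compact (Lam := Lam) (opY := opY) (fun _ => True)) with (F := F)
      as [l [Hl Hlc]].
    - intros i. apply (Hk i).
    - exact HF.
    - intros x _. exact (Hcov x Logic.I).
    - exists l. split; [exact Hl|]. intros x _. apply Hlc.
      destruct (bs_case x) as [->|[i [a [y [b ->]]]]]; [auto|]. right. exists i, a, y, b. auto. }
  split; [apply brandt_sum_hausdorff; [exact HT|intros i; apply (Hk i)]|].
  split; [|split].
  - split; [|split].
    + intros x x' H. destruct (os_case Hsum x) as [->|[i [a [g [b ->]]]]];
        destruct (os_case Hsum x') as [->|[i' [a' [g' [b' ->]]]]]; auto;
        rewrite ?jz, ?jE in H; try discriminate.
      pose proof (bs_index _ _ _ _ _ _ _ _ H). subst i'. apply bs_inj in H.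
      destruct H as [-> [H ->]]. destruct (Hk i) as [_ [_ [_ [[Hinj _] _]]]].
      apply Hinj in H. rewrite H. reflexivity.
    + intros V [HV HV0]. apply Hopen. split.
      * intros i a b. destruct (Hk i) as [_ [_ [_ [[_ [Hc _]] _]]]].
        apply (op_ext _ (fun g => V (bs i a (k i g) b))); [intros g; rewrite jE; tauto|].
        exact (Hc _ (HV i a b)).
      * rewrite jz. intros Vz. destruct (HV0 Vz) as [l Hl]. exists l.
        intros i a b Hi g. rewrite jE. apply Hl, Hi.
    + intros V HV. destruct (proj1 (Hopen V) HV) as [HVs HVz].
      (* The largest extension of [V]: a point belongs to it when some neighbourhood in its block
         has its trace inside [V]. *)
      exists (fun w => (w = None /\ V z) \/ exists i a y b, w = bs i a y b /\
        exists O, opY i O /\ O y /\ forall g, O (k i g) -> V (E i a g b)).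
      assert (Hbs : forall i a y b, (exists i0 a0 y0 b0, bs i a y b = bs i0 a0 y0 b0 /\
         exists O, opY i0 O /\ O y0 /\ forall g, O (k i0 g) -> V (E i0 a0 g b0)) ->
         exists O, opY i O /\ O y /\ forall g, O (k i g) -> V (E i a g b)).
      { intros i a y b [i0 [a0 [y0 [b0 [H HO]]]]].
        pose proof (bs_index _ _ _ _ _ _ _ _ H). subst i0. apply bs_inj in H.
        destruct H as [-> [-> ->]]. exact HO. }
      split; [split|].
      * intros i a b. apply (op_local _ (HT i)). intros y [[H _]|Hy]; [discriminate|].
        destruct (Hbs i a y b Hy) as [O [HO [Oy HOV]]].
        exists O. split; [exact HO|split; [exact Oy|]]. intros y' Oy'. right.
        exists i, a, y', b. split; [reflexivity|]. exists O. auto.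
      * intros [[_ Vz]|[i [a [y [b [H _]]]]]]; [|discriminate].
        destruct (HVz Vz) as [l Hl]. exists l. intros i a b Hi y. right.
        exists i, a, y, b. split; [reflexivity|]. exists (fun _ => True).
        split; [apply op_true, HT|]. split; [exact Logic.I|]. intros g _. apply Hl, Hi.
      * intros x. destruct (os_case Hsum x) as [->|[i [a [g [b ->]]]]].
        -- rewrite jz. split; [auto|]. intros [[_ H]|[i [a [y [b [H _]]]]]]; [exact H|discriminate].
        -- rewrite jE. split.
           ++ intros Vg. right. exists i, a, (k i g), b. split; [reflexivity|].
              destruct (Hk i) as [_ [_ [_ [[_ [_ Ho]] _]]]].
              destruct (Ho _ (HVs i a b)) as [O [HO HOV]]. exists O.
              split; [exact HO|]. split; [apply HOV, Vg|]. intros h. apply HOV.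
           ++ intros [[H _]|H]; [discriminate|].
              destruct (Hbs i a _ b H) as [O [_ [Oy HOV]]]. auto.
  - intros U [HU _] [x Ux]. destruct (bs_case x) as [->|[i [a [y [b ->]]]]].
    + exists None. split; [exact Ux|]. exists z. auto.
    + destruct (Hk i) as [_ [_ [_ [_ [Hd _]]]]].
      destruct (Hd _ (HU i a b) (ex_intro _ y Ux)) as [y' [Uy' [g ->]]].
      exists (bs i a (k i g) b). split; [exact Uy'|]. exists (E i a g b). auto.
  - intros f Hf [M HM].
    assert (Hfs : forall i a b, continuous (opG i) R_top (fun g => f (E i a g b))).
    { intros i a b V HV. exact (proj1 (proj1 (Hopen _) (Hf V HV)) i a b). }
    assert (Hext : forall p : {i : I & (Lam i * Lam i)%type}, exists F : Y (projT1 p) -> R,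
      continuous (opY (projT1 p)) R_top F /\
      forall g, F (k _ g) = f (E (projT1 p) (fst (projT2 p)) g (snd (projT2 p)))).
    { intros [i [a b]]. simpl. destruct (Hk i) as [_ [_ [_ [_ [_ He]]]]].
      apply He; [apply Hfs|]. exists M. auto. }
    pose (F := fun p => proj1_sig (constructive_indefinite_description _ (Hext p))).
    assert (HF : forall i a b, continuous (opY i) R_top (F (blk i a b)) /\
      forall g, F (blk i a b) (k i g) = f (E i a g b)).
    { intros i a b. unfold F.
      exact (proj2_sig (constructive_indefinite_description _ (Hext (blk i a b)))). }
    exists (fun x => match x with Some s => F (projT1 s) (projT2 s) | None => f z end).
    split.
    + intros V HV. split.
      * intros i a b. simpl. exact (proj1 (HF i a b) V HV).
      * intros Vz. destruct (HV _ Vz) as [eps [He HVe]].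
        (* Outside finitely many blocks [f] is within [eps/2] of [f z]; density of [G i] in [Y i]
           costs another [eps/2] when passing to the extension. *)
        destruct (proj2 (proj1 (Hopen _) (Hf _ (ball_R_top (f z) (eps / 2))))) as [l Hl].
        { rewrite Rminus_diag, Rabs_R0. lra. }
        exists l. intros i a b Hi y. simpl. apply HVe. destruct (HF i a b) as [Hc HFk].
        destruct (Hk i) as [_ [_ [_ [_ [Hd _]]]]].
        destruct (Hd _ (Hc _ (ball_R_top (F (blk i a b) y) (eps / 2)))) as [y' [Hy' [g ->]]].
        { exists y. rewrite Rminus_diag, Rabs_R0. lra. }
        rewrite HFk in Hy'. specialize (Hl i a b Hi g).
        revert Hl Hy'. unfold Rabs. repeat destruct Rcase_abs; lra.
    + intros x. destruct (os_case Hsum x) as [->|[i [a [g [b ->]]]]].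
      * rewrite jz. reflexivity.
      * rewrite jE. apply (HF i a b).
Qed.

Theorem theorem4p3
  (S : Type) (opS : (S -> Prop) -> Prop) (m : S -> S -> S) (z : S)
  (I : Type) (Lam : I -> Type) (G : I -> Type)
  (gm : forall i, G i -> G i -> G i) (ge : forall i, G i) (ginv : forall i, G i -> G i)
  (E : forall i, Lam i -> G i -> Lam i -> S) (alpha : forall i, Lam i)
  (HS : semitopological_semigroup opS m)
  (Hreg : regular opS)
  (Hcc : countably_compact opS)
  (HG : forall i, is_group (gm i) (ge i) (ginv i))
  (Hsum : orth_sum_decomp Lam G gm m z E)
  (Hcond : forall i,
     let opG := pullback opS (fun g => E i (alpha i) g (alpha i)) in
     left_precompact opG (gm i) (ge i) \/
     (left_omega_precompact opG (gm i) (ge i) /\ pseudocompact opG) \/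
     jointly_continuous_on opS m
       (fun x => x = z \/ exists g, x = E i (alpha i) g (alpha i))) :
  tychonoff opS /\
  exists (B : Type) (opB : (B -> Prop) -> Prop) (j : S -> B),
    stone_cech opS opB j /\
    exists mB : B -> B -> B,
      semitopological_semigroup opB mB /\
      inverse_semigroup mB /\
      (exists zB, primitive_with_zero mB zB) /\
      (exists invB : B -> B,
         (forall x, mB (mB x (invB x)) x = x /\ mB (mB (invB x) x) (invB x) = invB x) /\
         continuous opB opB invB) /\
      (forall x y, j (m x y) = mB (j x) (j y)) /\
      exists (BG : I -> Type) (opBG : forall i, (BG i -> Prop) -> Prop)
             (bm : forall i, BG i -> BG i -> BG i) (be : forall i, BG i)
             (binv : forall i, BG i -> BG i) (k : forall i, G i -> BG i)
             (EB : forall i, Lam i -> BG i -> Lam i -> B),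
        (forall i,
           topological_group (opBG i) (bm i) (be i) (binv i) /\
           compact_space (opBG i) /\
           stone_cech (pullback opS (fun g => E i (alpha i) g (alpha i))) (opBG i) (k i) /\
           (forall g h, k i (gm i g h) = bm i (k i g) (k i h))) /\
        orth_sum_decomp Lam BG bm mB (j z) EB /\
        (forall i a g b, EB i a (k i g) b = j (E i a g b)) /\
        (forall i, compact_on opB (brandt_block EB (j z) i)) /\
        (forall i a, embedding (opBG i) opB (fun g => EB i a g a)).
Proof.
  split; [exact (semigroup_tychonoff HS Hreg Hcc HG Hsum Hcond)|].
  pose (HTG := block_topological_group (alpha := alpha) HS Hreg Hcc HG Hsum).
  pose (HC := block_countably_compact (alpha := alpha) HS Hreg Hcc HG Hsum Hcond).
  pose (BG := fun i => completion (op := opG (opS := opS) (E := E) (alpha := alpha) i)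
    (m := gm i) (e := ge i) (inv := ginv i)).
  pose (opBG := fun i => completion_open : (BG i -> Prop) -> Prop).
  pose (bm := fun i => completion_mul (HTG i) (HC i) : BG i -> BG i -> BG i).
  pose (binv := fun i => completion_inv (HTG i) : BG i -> BG i).
  pose (k := fun i => to_completion (HTG i) (HC i) : G i -> BG i).
  assert (HBG : forall i, topological_group (opBG i) (bm i) (k i (ge i)) (binv i))
    by (intros i; apply completion_topological_group).
  assert (Hk : forall i, stone_cech (opG i) (opBG i) (k i))
    by (intros i; apply completion_stone_cech).
  assert (Hkm : forall i g h, k i (gm i g h) = bm i (k i g) (k i h))
    by (intros i g h; apply to_completion_mul).
  (* From here on only the group structure, the homomorphism [k] and the Stone-Cech property are
     used; the filters are forgotten. *)
  clearbody bm binv k opBG. clearbody BG. clear HTG HC.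
  assert (Hd : orth_sum_decomp Lam BG bm brandt_sum_mul None bs) by apply brandt_sum_decomp.
  assert (HBg : forall i, is_group (bm i) (k i (ge i)) (binv i)) by (intros i; apply (HBG i)).
  assert (Hj : forall x, exists w : brandt_sum (Lam := Lam) (Y := BG), (x = z /\ w = None) \/
    exists i a g b, x = E i a g b /\ w = bs i a (k i g) b).
  { intros x. destruct (os_case Hsum x) as [->|[i [a [g [b ->]]]]].
    - exists None. auto.
    - exists (bs i a (k i g) b). right. exists i, a, g, b. auto. }
  destruct (choice _ Hj) as [j Hj']. clear Hj.
  assert (jz : j z = None).
  { destruct (Hj' z) as [[_ H]|[i [a [g [b [H _]]]]]]; [exact H|].
    destruct (os_neq0 Hsum _ _ _ _ (eq_sym H)). }
  assert (jE : forall i a g b, j (E i a g b) = bs i a (k i g) b).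
  { intros i a g b. destruct (Hj' (E i a g b)) as [[H _]|[i' [a' [g' [b' [H ->]]]]]].
    - destruct (os_neq0 Hsum _ _ _ _ H).
    - pose proof (os_index Hsum _ _ _ _ _ _ _ _ H). subst i'.
      apply (os_inj Hsum) in H. destruct H as [<- [<- <-]]. reflexivity. }
  clear Hj'.
  exists brandt_sum, (brandt_sum_open (opY := opBG)), j.
  split.
  { apply (brandt_sum_stone_cech Hsum (opG := opG (opS := opS) (E := E) (alpha := alpha))
      (open_iff HS Hreg Hcc HG Hsum Hcond) Hk j jz jE). }
  exists (brandt_sum_mul (ym := bm)).
  split; [exact (brandt_sum_semitopological HBG)|].
  split; [exact (orth_sum_inverse_semigroup Hd HBg)|].
  split; [exists None; exact (orth_sum_primitive Hd HBg)|].
  split.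
  { exists (brandt_sum_inv (yinv := binv)). split.
    - exact (brandt_sum_inv_spec HBG).
    - exact (brandt_sum_inv_continuous HBG). }
  split.
  { intros x y. destruct (os_case Hsum x) as [->|[i [a [g [b ->]]]]].
    - rewrite (os_0l Hsum), jz, (os_0l Hd). reflexivity.
    - destruct (os_case Hsum y) as [->|[i' [c [h [d ->]]]]].
      + rewrite (os_0r Hsum), jz, (os_0r Hd). reflexivity.
      + rewrite !jE. destruct (classic (i = i')) as [<-|Hi].
        * destruct (classic (b = c)) as [<-|Hb].
          -- rewrite (os_mul Hsum), (os_mul Hd), jE, Hkm. reflexivity.
          -- rewrite (os_mul0 Hsum), (os_mul0 Hd) by assumption. exact jz.
        * rewrite (os_mul0_index Hsum), (os_mul0_index Hd) by assumption. exact jz. }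
  exists BG, opBG, bm, (fun i => k i (ge i)), binv, k, bs. rewrite jz.
  split; [|split; [exact Hd|split; [|split]]].
  - intros i. split; [exact (HBG i)|split; [apply (Hk i)|split; [exact (Hk i)|apply Hkm]]].
  - intros i a g b. symmetry. apply jE.
  - intros i F HF Hcov.
    destruct (brandt_sum_compact (Lam := Lam) (opY := opBG) (fun i' => i' = i)) with (F := F)
      as [l [Hl Hlc]].
    + intros i'. apply (Hk i').
    + exact HF.
    + intros x [->|[i' [a [y [b [-> ->]]]]]]; apply Hcov; [left; reflexivity|].
      right. exists a, y, b. reflexivity.
    + exists l. split; [exact Hl|]. intros x [->|[a [y [b ->]]]]; apply Hlc; [auto|].
      right. exists i, a, y, b. auto.
  - exact (brandt_sum_diagonal_embedding HBG).
Qed.
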